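(* Let $k$ be a field and let $(\Delta,\pi)$ be a balanced simplicial complex of dimension $d-1$ with ordered partition $\pi=(V_1,\dots,V_d)$. Then $$\operatorname{depth} k[\Delta]=\min\{\,i+|S| \;:\; i\ge 0,\ S\subseteq[d],\ \tilde H_{i-1}(\tilde\Delta_S;k)\ne 0\,\},$$ where $[d]=\{1,\dots,d\}$.
   Context: Simplicial complexes are finite, contain the empty face $\varnothing$, and contain $\{v\}$ for every vertex $v$. $k[\Delta]$ denotes the Stanley-Reisner ring of $\Delta$ over $k$, and $\operatorname{depth} k[\Delta]$ is its depth as a graded $k$-algebra (with respect to the homogeneous maximal ideal). $\tilde H_i$ is reduced simplicial homology, with $\tilde H_{-1}(\{\varnothing\};k)=k$. A balanced simplicial complex of dimension $d-1$ is a pair $(\Delta,\pi)$ where $\Delta$ is a $(d-1)$-dimensional simplicial complex on vertex set $V$, $\pi=(V_1,\dots,V_d)$ is an ordered partition of $V$, and $|F\cap V_i|\le 1$ for every face $F\in\Delta$ and every $i\in[d]$. For $S\subseteq[d]$, $\tilde\Delta_S=\{\sigma\in\Delta : \sigma\cap V_i=\varnothing \text{ for all } i\in S\}$ is the subcomplex of $\Delta$ induced on $\bigcup_{i\in[d]\setminus S}V_i$ (so $\tilde\Delta_{[d]}=\{\varnothing\}$). *)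

(* Defs.v *)
From HB Require Import structures.
From mathcomp Require Import all_boot all_order all_algebra.
From mathcomp Require Import ring_quotient.
From mathcomp Require Import mpoly.
From mathcomp Require Import boolp.

Set Implicit Arguments.
Unset Strict Implicit.
Unset Printing Implicit Defensive.

Import GRing.Theory.
Local Open Scope ring_scope.

(* The vertex set is the whole finite type V; the empty set is a face.        *)
Record simplicial_complex (V : finType) := SimplicialComplex {
  faces :> {set {set V}};
  face_empty : set0 \in faces;
  face_vertex : forall v : V, [set v] \in faces;
  face_subset : forall F G : {set V}, G \subset F -> F \in faces -> G \in faces
}.

(* max (#|F| - 1), so that the complex {set0} has dimension -1.               *)
Definition dimension (V : finType) (D : simplicial_complex V) : int :=
  (\max_(F in faces D) #|F|)%N%:Z - 1.

(* The blocks are automatically nonempty: a face with d vertices exists and   *)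
(* meets each of the d blocks in exactly one vertex.                          *)
Record balanced (V : finType) (d : nat) (D : simplicial_complex V)
    (P : 'I_d -> {set V}) : Prop := Balanced {
  balanced_dim : dimension D = d%:Z - 1;
  balanced_cover : \bigcup_(i < d) P i = [set: V];
  balanced_disjoint : forall i j : 'I_d, i != j -> [disjoint P i & P j];
  balanced_face : forall (F : {set V}) (i : 'I_d),
    F \in faces D -> (#|F :&: P i| <= 1)%N
}.

(* A set of faces rather than a simplicial_complex V: its vertices do not     *)
(* exhaust V.                                                                 *)
Definition color_deleted (V : finType) (d : nat) (D : simplicial_complex V)
    (P : 'I_d -> {set V}) (S : {set 'I_d}) : {set {set V}} :=
  [set F in faces D | [forall i in S, F :&: P i == set0]].

Section ReducedHomology.

Variables (k : fieldType) (V : finType).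

(* Formal k-linear combinations of subsets of V.                              *)
Definition chain := {ffun {set V} -> k^o}.

Definition basic_chain (F : {set V}) : chain := [ffun G => (G == F)%:R].

(* The position of v in F, for the order of V given by its enumeration.       *)
Definition vertex_pos (F : {set V}) (v : V) : nat :=
  #|[set w in F | (enum_rank w < enum_rank v)%N]|.

Definition boundary_fun (c : chain) : chain :=
  \sum_(F : {set V})
     c F *: \sum_(v in F) (-1) ^+ vertex_pos F v *: basic_chain (F :\ v).

Lemma boundary_fun_is_linear : linear boundary_fun.
Proof.
move=> a b c; rewrite /boundary_fun scaler_sumr -big_split /=.
by apply: eq_bigr => F _; rewrite !ffunE scalerDl scalerA.
Qed.

HB.instance Definition _ :=
  GRing.isLinear.Build k chain chain *:%R boundary_fun boundary_fun_is_linear.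

Definition boundary : 'End(chain) := linfun boundary_fun.

(* K is meant to be closed under taking subsets, as is every subcomplex.      *)
Variable K : {set {set V}}.

(* A face F has dimension #|F| - 1, and set0 spans the chains of degree -1.   *)
Definition chains (p : int) : {vspace chain} :=
  <<[seq basic_chain F | F in [set F in K | #|F|%:Z - 1 == p]]>>%VS.

Definition cycles (p : int) : {vspace chain} :=
  (chains p :&: lker boundary)%VS.

Definition boundaries (p : int) : {vspace chain} :=
  (boundary @: chains (p + 1))%VS.

(* The boundaries, as a subgroup of the group of cycles.                      *)
Definition boundary_cycles (p : int) : {pred subvs_of (cycles p)} :=
  fun z => vsval z \in boundaries p.
Arguments boundary_cycles : clear implicits.

Lemma boundary_cycles_zmod_closed p : zmod_closed (boundary_cycles p).
Proof.
split=> [|x y]; first exact: mem0v.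
rewrite -!topredE /= /boundary_cycles => xB yB; rewrite linearB; exact: memvB.
Qed.

HB.instance Definition _ (p : int) :=
  GRing.isZmodClosed.Build (subvs_of (cycles p)) (boundary_cycles p)
    (boundary_cycles_zmod_closed p).

Definition reduced_homology (p : int) : zmodType :=
  Quotient.quot (boundary_cycles p).

End ReducedHomology.

Section Depth.

Variable R : comNzRingType.

Definition in_ideal (s : seq R) (r : R) : Prop :=
  exists a : nat -> R, r = \sum_(i < size s) a i * s`_i.

Definition regular_sequence (s : seq R) : Prop :=
  (forall i : nat, (i < size s)%N -> forall r : R,
     in_ideal (take i s) (s`_i * r) -> in_ideal (take i s) r)
  /\ ~ in_ideal s 1.

(* n is the largest length of a regular sequence in the ideal generated by m. *)
(* For a standard graded algebra and its homogeneous maximal ideal, allowing  *)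
(* nonhomogeneous elements does not change this number.                       *)
Definition is_depth (m : seq R) (n : nat) : Prop :=
  (exists s : seq R, [/\ regular_sequence s,
     forall r, r \in s -> in_ideal m r & size s = n])
  /\ (forall s : seq R, regular_sequence s ->
        (forall r, r \in s -> in_ideal m r) -> (size s <= n)%N).

End Depth.

Section StanleyReisner.

Variables (k : fieldType) (V : finType) (D : simplicial_complex V).

Definition vertex_var (v : V) : {mpoly k[#|V|]} := 'X_(enum_rank v).

Definition sr_generators : seq {mpoly k[#|V|]} :=
  [seq \prod_(v in F) vertex_var v | F : {set V} in ~: faces D].

Definition sr_ideal : {pred {mpoly k[#|V|]}} :=
  fun p => `[< in_ideal sr_generators p >].

Lemma sr_ideal_closed : idealr_closed sr_ideal.
Proof.
split.
- apply/asboolP; exists (fun=> 0).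
  by rewrite big1 // => i _; rewrite mul0r.
- apply/asboolP => -[a /(congr1 (mcoeff 0%MM))].
  rewrite mcoeff1 eqxx raddf_sum /= => /eqP; apply/negP; rewrite big1 ?oner_eq0 //.
  move=> i _; have := mem_nth 0 (ltn_ord i).
  case/imageP => F; rewrite inE => FD ->.
  have [v vF] : exists v, v \in F.
    by apply/set0Pn; apply: contra FD => /eqP ->; exact: face_empty.
  by rewrite (bigD1 v) //= !rmorphM /= mcoeffX mnm1_eq0 !(mul0r, mulr0).
- move=> a u v /asboolP [b ->] /asboolP [c ->]; apply/asboolP.
  exists (fun i => a * b i + c i).
  rewrite mulr_sumr -big_split /=; apply: eq_bigr => i _.
  by rewrite mulrDl mulrA.
Qed.

HB.instance Definition _ :=
  isIdealr.Build {mpoly k[#|V|]} sr_ideal sr_ideal_closed.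

Definition sr_ring : comNzRingType := {ideal_quot sr_ideal}.

(* Generators, in k[D], of the homogeneous maximal ideal.                      *)
Definition irrelevant_ideal : seq sr_ring :=
  [seq (\pi_({ideal_quot sr_ideal}) (vertex_var v))%qT | v : V].

End StanleyReisner.

Definition is_minimum (A : nat -> Prop) (n : nat) : Prop :=
  A n /\ forall m, A m -> (n <= m)%N.

(* Main.v *)
(** Let theta_i be the sum of the variables of colour i, and let K(theta) be its
    Koszul complex over R = k[D].  Every variable satisfies x_v^2 = x_v theta_i in
    R, so the irrelevant ideal is the radical of (theta), and its depth is d minus
    the largest j with H_j(theta; R) <> 0.  K(theta) is graded by N^d.  In a degree
    with an entry at least 2, division by theta_i is a contracting homotopy; in the
    squarefree degree with support T, the complex is the cochain complex of the
    subcomplex of colours T, shifted so that H_j is the reduced cohomology of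
    degree #|T| - j - 1.  With T the complement of S, d - j = i + #|S|.

    Regular sequences are compared with Koszul homology one element at a time.  An
    element s of the radical that is regular on M acts nilpotently on H_j(M), and
    injectively if H_{j+1}(M/s) = 0, which bounds the length of regular sequences.
    Conversely, if H_d(M) = 0 then no nonzero element of M is killed by the
    irrelevant ideal, and prime avoidance over a Noetherian ring gives a regular
    element. *)

From HB Require Import structures.
Require Import Defs.
From mathcomp Require Import all_boot all_order all_algebra.
From mathcomp Require Import ring_quotient mpoly boolp.
From mathcomp Require Import ring zify.

Set Implicit Arguments.
Unset Strict Implicit.
Unset Printing Implicit Defensive.

Import Order.TTheory GRing.Theory.
Local Open Scope ring_scope.

(** * Ideals and regular elements *)

Section Ideals.

Variable R : comNzRingType.
Implicit Types (I J : R -> Prop) (s t : seq R) (x y r : R).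

(** Ideals are bare predicates and may be the whole ring. The module R/J is handled by congruences
    modulo [J], so a regular sequence needs no tower of quotient rings. *)
Record is_ideal J : Prop := IsIdeal {
  ideal0 : J 0;
  idealD : forall x y, J x -> J y -> J (x + y);
  idealM : forall a x, J x -> J (a * x)
}.

Lemma idealMl J a x : is_ideal J -> J x -> J (x * a).
Proof. by move=> iJ Jx; rewrite mulrC; apply: (idealM iJ). Qed.

Lemma idealN J x : is_ideal J -> J x -> J (- x).
Proof. by move=> iJ Jx; rewrite -mulN1r; apply: (idealM iJ). Qed.

Lemma idealB J x y : is_ideal J -> J x -> J y -> J (x - y).
Proof. by move=> iJ Jx Jy; apply: (idealD iJ) => //; apply: idealN. Qed.

Lemma idealDr J x y : is_ideal J -> J y -> J (x + y) -> J x.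
Proof. by move=> iJ Jy Jxy; rewrite -[x](addrK y); apply: idealB. Qed.

Lemma ideal_sum J (K : Type) (l : seq K) (P : pred K) (F : K -> R) :
  is_ideal J -> (forall i, P i -> J (F i)) -> J (\sum_(i <- l | P i) F i).
Proof.
by move=> iJ JF; apply: (big_ind J); [exact: ideal0 | exact: idealD |].
Qed.

Lemma in_ideal_is_ideal s : is_ideal (in_ideal s).
Proof.
split.
- by exists (fun=> 0); rewrite big1 // => i _; rewrite mul0r.
- move=> x y [a ->] [b ->]; exists (fun i => a i + b i).
  by rewrite -big_split; apply: eq_bigr => i _; rewrite mulrDl.
- move=> c x [a ->]; exists (fun i => c * a i).
  by rewrite mulr_sumr; apply: eq_bigr => i _; rewrite mulrA.
Qed.

Lemma mem_in_ideal s x : x \in s -> in_ideal s x.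
Proof.
move=> xs; have ix : (index x s < size s)%N by rewrite index_mem.
exists (fun i => (i == index x s)%:R).
rewrite (bigD1 (Ordinal ix)) //= eqxx mul1r nth_index // big1 ?addr0 //.
by move=> i /negPf; rewrite -val_eqE /= => ->; rewrite mul0r.
Qed.

Lemma in_ideal_min J s x :
  is_ideal J -> (forall y, y \in s -> J y) -> in_ideal s x -> J x.
Proof.
move=> iJ sJ [a ->]; apply: ideal_sum => // i _.
by apply: (idealM iJ); apply/sJ/mem_nth.
Qed.

Lemma in_ideal_nil x : in_ideal [::] x -> x = 0.
Proof. by case=> a ->; rewrite big_ord0. Qed.

Definition adjoin J x : R -> Prop := fun r => exists a, J (r - a * x).

Lemma in_ideal_rcons s x r : in_ideal (rcons s x) r <-> adjoin (in_ideal s) x r.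
Proof.
split=> [[a ->]|[a [b Eb]]].
- rewrite size_rcons big_ord_recr /= nth_rcons ltnn eqxx; exists (a (size s)).
  rewrite addrK; exists a; apply: eq_bigr => i _.
  by rewrite /= nth_rcons ltn_ord.
- exists (fun i => if (i < size s)%N then b i else a).
  rewrite size_rcons big_ord_recr /= nth_rcons !ltnn eqxx.
  rewrite -[LHS](subrK (a * x)) Eb; congr (_ + _); apply: eq_bigr => i _.
  by rewrite /= nth_rcons ltn_ord.
Qed.

(** The ascending chain condition in the form in which it is used: a chain that grows by one
    generator at a time cannot grow for ever. *)
Definition noetherian :=
  forall f : nat -> R, exists n, in_ideal (mkseq f n) (f n).

Definition regular_mod J x := forall r, J (x * r) -> J r.

Section RegularElement.

Hypothesis noethR : noetherian.
Variable J : R -> Prop.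
Hypothesis iJ : is_ideal J.

(** Inclusion of the annihilators [J : c] and [J : c'] of two classes in R/J. *)
Definition colon_le c c' := forall r, J (r * c) -> J (r * c').

Definition max_colon c :=
  ~ J c /\ forall c', ~ J c' -> colon_le c c' -> colon_le c' c.

(** Otherwise dependent choice gives a strictly increasing chain of colons, and the elements that
    witness strictness contradict [noethR]. *)
Lemma max_colon_above c0 : ~ J c0 -> exists2 c, max_colon c & colon_le c0 c.
Proof.
move=> Jc0; apply: contrapT => nomax.
pose T := {c | ~ J c /\ colon_le c0 c}.
have step (c : T) : exists p : T * R,
    [/\ colon_le (sval c) (sval p.1), J (p.2 * sval p.1)
      & ~ J (p.2 * sval c)].
  case: c => c [Jc c0c] /=; apply: contrapT => nostep; apply: nomax.
  exists c => //; split=> // c' Jc' cc' r Jr; apply: contrapT => nJr.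
  have c0c' : colon_le c0 c' by move=> z /c0c /cc'.
  apply: nostep; by exists (exist _ c' (conj Jc' c0c'), r).
have [g gP] := choice step.
pose c n : T := iter n (fst \o g) (exist _ c0 (conj Jc0 (fun r Jr => Jr))).
have c_mono n m : (n <= m)%N -> colon_le (sval (c n)) (sval (c m)).
  elim: m => [|m IHm]; first by rewrite leqn0 => /eqP ->.
  rewrite leq_eqVlt => /predU1P [-> //|]; rewrite ltnS => /IHm nm r /nm Jr.
  by have [+ _ _] := gP (c m); apply.
have [n] := noethR (fun n => (g (c n)).2).
have [_ _ nJ] := gP (c n); apply: contra_not nJ.
suff: forall r, in_ideal (mkseq (fun i => (g (c i)).2) n) r -> J (r * sval (c n)).
  by apply.
move=> r; apply: (in_ideal_min (J := fun r => J (r * sval (c n)))).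
  split=> [|x y Jx Jy|a x Jx]; rewrite ?mul0r ?mulrDl -?mulrA.
  - exact: ideal0.
  - exact: idealD.
  - exact: idealM.
move=> y /mapP [i]; rewrite mem_iota add0n => /andP [_ ltin] ->.
by apply: (c_mono i.+1 n) => //; have [_ + _] := gP (c i).
Qed.

(** The colon of [b * c] contains that of [c], so maximality makes them equal. *)
Lemma max_colon_prime c a b :
  max_colon c -> J (a * b * c) -> ~ J (b * c) -> J (a * c).
Proof.
move=> [_ cmax] Jabc nJbc; apply: (cmax (b * c)) => //; last by rewrite mulrA.
by move=> r Jrc; rewrite mulrCA; apply: idealM.
Qed.

(** As [J : c] is prime, a product of elements of the other colons, each chosen outside [J : c],
    stays outside. *)
Lemma colon_separate c (cs : seq R) : max_colon c ->
  (forall c', c' \in cs -> ~ colon_le c' c) ->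
  exists2 u, (forall c', c' \in cs -> J (u * c')) & ~ J (u * c).
Proof.
move=> cmax; elim: cs => [|c1 cs IHcs] sep.
  by exists 1; rewrite // mul1r; case: cmax.
case: IHcs => [c' c'cs|u uJ nJuc]; first by apply: sep; rewrite inE c'cs orbT.
have /existsNP [v /not_implyP [Jvc1 nJvc]] := sep c1 (mem_head _ _).
exists (v * u) => [c'|/(max_colon_prime cmax)/(_ nJuc) //].
rewrite inE => /predU1P [->|/uJ Juc'].
  by rewrite mulrAC; apply: idealMl.
by rewrite -mulrA; apply: idealM.
Qed.

(** Modulo [J], finitely many maximal elements [cs] generate all the others. If no colon of [cs] lay
    in [J : c], some [u] would kill all of [cs] but not their combination [c]. *)
Lemma max_colon_finite : exists cs : seq R,
  (forall c, c \in cs -> max_colon c) /\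
  (forall c, max_colon c -> exists2 c', c' \in cs & colon_le c' c).
Proof.
pose T := {c | max_colon c}.
have [cs csP] : exists cs : seq T, forall c, max_colon c ->
    exists2 x, in_ideal (map sval cs) x & J (c - x).
  apply: contrapT => /forallNP noc.
  have step (cs : seq T) : exists c : T,
      ~ exists2 x, in_ideal (map sval cs) x & J (sval c - x).
    have /existsNP [c /not_implyP [cmax nc]] := noc cs.
    by exists (exist _ c cmax).
  have [g gP] := choice step.
  pose L n := iter n (fun cs => rcons cs (g cs)) [::].
  have EL n : map sval (L n) = mkseq (fun i => sval (g (L i))) n.
    by elim: n => // n IHn; rewrite /= map_rcons IHn mkseqS.
  have [n inL] := noethR (fun i => sval (g (L i))).
  case: (gP (L n)); exists (sval (g (L n))); first by rewrite EL.
  by rewrite subrr; apply: ideal0.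
exists (map sval cs); split=> [c|c cmax].
  by elim: cs {csP} => //= -[x xmax] cs IHcs; rewrite inE => /predU1P [->|].
apply: contrapT => nsep.
case: (@colon_separate c (map sval cs)) => //.
  by move=> c' c'cs c'c; apply: nsep; exists c'.
move=> u uJ; case; have [x xcs Jcx] := csP _ cmax.
rewrite -[c](subrK x) mulrDr; apply: idealD => //; first exact: idealM.
rewrite mulrC; move: x xcs {Jcx} => x; apply: (in_ideal_min (J := fun r => J (r * u))).
  split=> [|y z Jy Jz|a y Jy]; rewrite ?mul0r ?mulrDl -?mulrA.
  - exact: ideal0.
  - exact: idealD.
  - exact: idealM.
by move=> y /uJ; rewrite mulrC.
Qed.

(* Prime avoidance for the finitely many maximal colons [J : c], which are the *)
(* maximal associated primes of [J].                                           *)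
Lemma exists_regular (m : seq R) :
  (forall c, ~ J c -> exists2 r, in_ideal m r & ~ J (r * c)) ->
  exists2 x, in_ideal m x & regular_mod J x.
Proof.
move=> nosocle; have im := in_ideal_is_ideal m.
have [cs [csmax cscover]] := max_colon_finite.
have [s sm sJ] : exists2 s, in_ideal m s & forall c, c \in cs -> ~ J (s * c).
  elim: cs csmax {cscover} => [|c cs IHcs] csmax.
    by exists 0; first exact: ideal0.
  have {}[|s sm sJ] := IHcs.
    by move=> c' c'cs; apply: csmax; rewrite inE c'cs orbT.
  have cmax := csmax c (mem_head _ _).
  have [Jsc|nJsc] := pselect (J (s * c)); last first.
    by exists s => // c'; rewrite inE => /predU1P [-> //|/sJ].
  have [t tm nJtc] := nosocle c cmax.1.
  have [c' c'cs c'c|u uJ nJuc] := @colon_separate c cs cmax.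
    have [|_ c'max] := csmax c'; first by rewrite inE c'cs orbT.
    by apply: (sJ c') => //; apply: (c'max c cmax.1).
  (* Here [s] already avoids the colons of [cs] but kills [c]. The correction [t * u] is killed by
     all of [cs] and does not kill [c]. *)
  exists (s + t * u); first by apply: idealD => //; apply: idealMl.
  move=> c'; rewrite inE mulrDl => /predU1P [->|c'cs].
    rewrite addrC => /(idealDr iJ Jsc) /(max_colon_prime cmax) /(_ nJuc).
    exact: nJtc.
  move=> Jsum; apply: (sJ c') => //; apply: (idealDr iJ) Jsum.
  by rewrite -mulrA; apply: idealM => //; apply: uJ.
(* If [s] kills a nonzero class [r], it lies in a maximal colon above [J : r], hence in one from the
   finite list. *)
exists s => // r Jsr; apply: contrapT => nJr.
have [c cmax rc] := max_colon_above nJr.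
have [c' c'cs c'c] := cscover _ cmax.
have [_ c'max] := csmax c' c'cs.
by apply: (sJ c') => //; apply: (c'max c cmax.1) => //; apply: rc.
Qed.

End RegularElement.

End Ideals.

(** * Hilbert's basis theorem *)

Lemma nat_min (P : nat -> Prop) :
  (exists n, P n) -> exists2 n, P n & forall m, P m -> (n <= m)%N.
Proof.
move=> exP; have exb : exists n, `[< P n >] by case: exP => n /asboolT; exists n.
case: (ex_minnP exb) => n /asboolP Pn nmin; exists n => // m /asboolT; exact: nmin.
Qed.

Lemma wf_min (T : Type) (lt : T -> T -> Prop) (P : T -> Prop) :
  well_founded lt -> (exists x, P x) ->
  exists2 x, P x & forall y, P y -> ~ lt y x.
Proof.
move=> wf [x Px]; apply: contrapT => nomin; elim/(well_founded_ind wf): x Px => x IHx Px.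
by apply: nomin; exists x => // y Py yx; apply: IHx yx Py.
Qed.

(** Choose repeatedly an index, beyond the previous one, at which [f] is minimal on the remaining
    tail. *)
Lemma nondecreasing_subseq (f : nat -> nat) : exists2 g : nat -> nat,
  {homo g : i j / (i < j)%N} & {homo f \o g : i j / (i <= j)%N}.
Proof.
have minf N : exists m, (N <= m)%N /\ forall k, (N <= k)%N -> (f m <= f k)%N.
  have [|_ [m Nm ->] fmin] := @nat_min (fun y => exists2 m, (N <= m)%N & y = f m).
    by exists (f N), N.
  by exists m; split=> // k Nk; apply: fmin; exists k.
have [h hP] := choice minf.
pose g n := iter n (fun m => h m.+1) (h 0).
have gS n : (g n < g n.+1)%N by rewrite /= (hP (g n).+1).1.
have g_homo : {homo g : i j / (i < j)%N} by apply: homo_ltn => //; apply: ltn_trans.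
exists g => //; apply: (homo_leq leqnn leq_trans) => -[|n] /=.
  by apply: (hP 0).2.
by apply: (hP (g n).+1).2; rewrite (leq_trans (gS n)) // ltnW.
Qed.

(** Pass to a nondecreasing subsequence for one coordinate after another; the first two terms of the
    last one are comparable. *)
Lemma dickson n (f : nat -> 'X_{1..n}) :
  exists i j, (i < j)%N /\ (f i <= f j)%MM.
Proof.
suff [g g_homo fg] : exists2 g : nat -> nat, {homo g : i j / (i < j)%N} &
    forall c, c \in enum 'I_n -> {homo (fun i => f (g i) c) : i j / (i <= j)%N}.
  exists (g 0), (g 1); split; first exact: g_homo.
  by apply/mnm_lepP => c; apply: (fg c) => //; rewrite mem_enum.
elim: (enum 'I_n) => [|c l [g g_homo fg]]; first by exists id.
have [h h_homo fh] := nondecreasing_subseq (fun i => f (g i) c).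
exists (g \o h) => [i j /h_homo /g_homo //|c'].
rewrite inE => /predU1P [-> //|/fg fgc'] i j ij; apply: fgc'.
by have := leq_mono h_homo i j; rewrite ij.
Qed.

(* Hilbert's basis theorem: in a strictly ascending chain choose elements      *)
(* [g N] of minimal leading monomial in the successive differences; by Dickson *)
(* one of them can be reduced by an earlier one.                               *)
Lemma mpoly_noetherian (k : fieldType) n : noetherian {mpoly k[n]}.
Proof.
move=> f; apply: contrapT => /forallNP fN.
pose I N := in_ideal (mkseq f N).
have idI N : is_ideal (I N) by apply: in_ideal_is_ideal.
have I_mono M N x : (M <= N)%N -> I M x -> I N x.
  move=> MN; apply: in_ideal_min => // _ /mapP [i + ->].
  rewrite mem_iota => /andP [_ iM]; apply: mem_in_ideal; apply/mapP.
  by exists i => //; rewrite mem_iota; lia.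
have gex N : exists p, (I N.+1 p /\ ~ I N p) /\
    forall q, I N.+1 q /\ ~ I N q -> ~ (mlead q < mlead p)%O.
  have [|_ [p Pp ->] pmin] := wf_min (@ltom_wf n)
    (P := fun m => exists2 p, I N.+1 p /\ ~ I N p & m = mlead p).
    exists (mlead (f N)), (f N) => //; split; last exact: fN.
    by apply: mem_in_ideal; apply/mapP; exists N => //; rewrite mem_iota /=; lia.
  by exists p; split=> // q Pq; apply: pmin; exists q.
have [g gP] := choice gex.
have [i [j [ij le_ij]]] := dickson (fun N => mlead (g N)).
have [[Igi nIgi] _] := gP i; have [[Igj nIgj] gjmin] := gP j.
have gi0 : mleadc (g i) != 0.
  by rewrite mleadc_eq0; apply/eqP => gi0; apply: nIgi; rewrite gi0; apply: ideal0.
pose a := 'X_[mlead (g j) - mlead (g i)] : {mpoly k[n]}.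
(* The multiple of [g i] with the leading term of [g j]; it lies in [I j] because i < j. *)
pose r := (mleadc (g j) / mleadc (g i)) *: (a * g i).
have Ir : I j r.
  by rewrite /r -mul_mpolyC; do 2!apply: idealM => //; apply: I_mono Igi.
have nIq : ~ I j (g j - r).
  by move=> /(fun H => idealD (idI j) H Ir); rewrite subrK.
have q0 : g j - r != 0 by apply/eqP => q0; apply: nIq; rewrite q0; apply: ideal0.
apply: (gjmin (g j - r)).
  by split=> //; apply: idealB => //; apply: I_mono Ir.
rewrite lt_neqAle; apply/andP; split; last first.
  apply: le_trans (mleadB_le _ _) _; rewrite leUx lexx /=.
  apply: le_trans (mleadZ_le _ _) _; apply: le_trans (mleadM_le _ _) _.
  by rewrite mleadXm submK.
(* The leading terms cancel, so an unchanged leading monomial would have coefficient 0. *)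
apply: contra_neq q0 => Eq; apply/eqP; rewrite -mleadc_eq0 Eq.
rewrite mcoeffB mcoeffZ mulrC /a.
have -> : ('X_[mlead (g j) - mlead (g i)] * g i)@_(mlead (g j)) = mleadc (g i).
  by rewrite mulrC -{1}(submK le_ij) mcoeffMX.
by rewrite mulrC divfK ?subrr.
Qed.

Lemma surj_noetherian (R Q : comNzRingType) (f : {rmorphism R -> Q}) :
  (forall y, exists x, f x = y) -> noetherian R -> noetherian Q.
Proof.
move=> f_surj noethR u; have [g gP] := choice f_surj.
have [n [a Ea]] := noethR (g \o u); exists n, (f \o a).
rewrite -(gP (u n)) [g _]Ea rmorph_sum !size_mkseq; apply: eq_bigr => i _.
by rewrite rmorphM /= !nth_mkseq //= gP.
Qed.

(** * The Koszul complex *)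

Section Koszul.

Variables (R : comNzRingType) (d : nat) (theta : 'I_d -> R).
Implicit Types (c b : {set 'I_d} -> R) (U W : {set 'I_d}) (J : R -> Prop).

Definition ksign W (i : 'I_d) : R := (-1) ^+ #|[set j in W | (j < i)%N]|.

(** The Koszul differential in coordinates: [c U] is the coefficient of the exterior basis element
    e_U, with all degrees kept in one function. *)
Definition koszul c W : R :=
  \sum_(i | i \notin W) ksign W i * theta i * c (i |: W).

Lemma ksignU1 W l i : l \notin W ->
  ksign (l |: W) i = (-1) ^+ (l < i)%N * ksign W i.
Proof.
move=> lW; rewrite /ksign -exprD; congr (_ ^+ _).
case: (ltnP l i) => li.
  have -> : [set j in l |: W | (j < i)%N] = l |: [set j in W | (j < i)%N].
    by apply/setP => j; rewrite !inE; case: eqP => // ->; rewrite li.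
  by rewrite cardsU1 !inE (negPf lW).
have -> : [set j in l |: W | (j < i)%N] = [set j in W | (j < i)%N]; last by [].
by apply/setP => j; rewrite !inE; case: eqP => // ->; rewrite ltnNge li !andbF.
Qed.

Lemma ksignK W i : ksign W i * ksign W i = 1.
Proof. by rewrite /ksign -exprD addnn -mul2n exprM sqrrN expr1n expr1n. Qed.

Lemma koszulD c b W : koszul (fun U => c U + b U) W = koszul c W + koszul b W.
Proof. by rewrite -big_split; apply: eq_bigr => i _; rewrite mulrDr. Qed.

Lemma koszulB c b W : koszul (fun U => c U - b U) W = koszul c W - koszul b W.
Proof. by rewrite -sumrB; apply: eq_bigr => i _; rewrite mulrBr. Qed.

Lemma koszulZ a c W : koszul (fun U => a * c U) W = a * koszul c W.
Proof. by rewrite mulr_sumr; apply: eq_bigr => i _; rewrite mulrCA. Qed.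

Lemma koszul_ideal J j c W : is_ideal J ->
  (forall U, #|U| = j.+1 -> J (c U)) -> #|W| = j -> J (koszul c W).
Proof.
move=> iJ Jc Wj; apply: ideal_sum => // i iW; apply: idealM => //.
by apply: Jc; rewrite cardsU1 iW Wj.
Qed.

(** Adding [i] and then [l] to [W] gives the opposite sign to adding [l] and then [i]. *)
Lemma koszul_koszul c W : koszul (koszul c) W = 0.
Proof.
pose F i l := ksign W i * theta i * (ksign (i |: W) l * theta l * c (l |: (i |: W))).
pose G i l := if (i \notin W) && (l \notin W) && (i != l) then F i l else 0.
have -> : koszul (koszul c) W = \sum_i \sum_l G i l.
  rewrite /koszul big_mkcond; apply: eq_bigr => i _; rewrite /G.
  case: ifP => iW; last by rewrite big1.
  rewrite mulr_sumr [LHS]big_mkcond; apply: eq_bigr => l _.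
  by rewrite in_setU1 negb_or eq_sym andbC; case: ifP.
have GN i l : G i l = - G l i.
  rewrite /G eq_sym [(l \notin W) && _]andbC.
  case: ifP => [/andP [/andP [iW lW] neq_li]|_]; last by rewrite oppr0.
  rewrite /F !ksignU1 // setUCA.
  have /orP [] : (i < l)%N || (l < i)%N by rewrite -neq_ltn eq_sym.
    by move=> il; rewrite il ltnNge ltnW //= expr1 expr0; ring.
  by move=> li; rewrite li ltnNge ltnW //= expr1 expr0; ring.
(* Antisymmetry alone does not suffice in characteristic 2, so the terms above and below the
   diagonal are paired. *)
rewrite (eq_bigr (fun i : 'I_d => \sum_(l : 'I_d | (i < l)%N) G i l
                    + \sum_(l : 'I_d | (l < i)%N) G i l)); last first.
  move=> i _; rewrite (bigID (fun l : 'I_d => (i < l)%N)) /=; congr (_ + _).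
  rewrite (bigD1 i) ?ltnn //= {1}/G eqxx andbF add0r; apply: eq_bigl => l.
  by rewrite -leqNgt ltn_neqAle andbC.
rewrite big_split /= [X in _ + X](exchange_big_dep predT) //= -big_split.
rewrite big1 // => i _; rewrite -big_split big1 // => l _ /=.
by rewrite [G l i]GN subrr.
Qed.

(** Exterior multiplication by e_i with [delta] applied to the coefficients. It is used with the
    identity and with division by [theta i]. *)
Definition koszul_homotopy (delta : R -> R) i c U : R :=
  if i \in U then ksign (U :\ i) i * delta (c (U :\ i)) else 0.

(** For l different from i, the two contributions have opposite signs and cancel because [delta]
    commutes with [theta l]. Only the term of index [i] survives, from the first summand if [i] is
    outside [W] and from the second otherwise. *)
Lemma koszul_homotopyE (delta : {additive R -> R}) i c W :
  (forall l r, l != i -> delta (theta l * r) = theta l * delta r) ->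
  koszul (koszul_homotopy delta i c) W + koszul_homotopy delta i (koszul c) W =
    if i \in W then delta (theta i * c W) else theta i * delta (c W).
Proof.
have deltaS U j x : delta (ksign U j * x) = ksign U j * delta x.
  exact: raddfMsign.
move=> deltaC; rewrite {2}/koszul_homotopy; case: ifPn => iW; last first.
  rewrite addr0 /koszul (bigD1 i) //= big1 => [|l /andP [lW neq_li]].
    rewrite addr0 /koszul_homotopy setU11 setU1K //.
    by rewrite mulrACA ksignK mul1r.
  by rewrite /koszul_homotopy in_setU1 eq_sym (negPf neq_li) (negPf iW) mulr0.
have iWi : i \notin W :\ i by rewrite setD11.
rewrite [koszul c _](bigD1 i) //= setD1K // raddfD raddf_sum mulrDr.
rewrite -mulrA deltaS mulrA ksignK mul1r addrCA -[RHS]addr0; congr (_ + _).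
rewrite mulr_sumr /koszul.
rewrite (eq_bigl (fun l => (l \notin W :\ i) && (l != i))) => [|l]; last first.
  by rewrite !inE negb_and negbK; have [->|] := eqVneq l i; rewrite ?iW ?andbT ?andbF.
rewrite -big_split big1 // => l /andP [lWi neq_li] /=.
have lW : l \notin W by move: lWi; rewrite !inE neq_li.
rewrite /koszul_homotopy in_setU1 iW orbT -!mulrA deltaS.
rewrite deltaC //.
have -> : (l |: W) :\ i = l |: (W :\ i).
  by apply/setP => x; rewrite !inE; case: (x =P l) => // ->; rewrite neq_li.
rewrite -{1}(setD1K iW) !ksignU1 //.
have /orP [] : (i < l)%N || (l < i)%N by rewrite -neq_ltn eq_sym.
  by move=> il; rewrite il ltnNge ltnW //= expr1 expr0; ring.
by move=> li; rewrite li ltnNge ltnW //= expr1 expr0; ring.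
Qed.

(* Vanishing of [H_j(theta; R/J)], elementwise.  Chains are functions on sets  *)
(* of all sizes, and only their values on sets of size [j] matter here.        *)
Definition koszul_exact J j :=
  forall c, (forall W, #|W|.+1 = j -> J (koszul c W)) ->
  exists b, forall U, #|U| = j -> J (c U - koszul b U).

Lemma koszul_exact_large J j : (d < j)%N -> koszul_exact J j.
Proof.
move=> dj c _; exists (fun=> 0) => U Uj.
by have := max_card (mem U); rewrite card_ord Uj leqNgt dj.
Qed.

(** An element killed by all [theta i] is a cycle of degree d, and the only boundary there is 0. *)
Lemma koszul_exact_top J x : is_ideal J -> koszul_exact J d ->
  (forall i, J (theta i * x)) -> J x.
Proof.
move=> iJ exJ Jx.
have [|b bP] := exJ (fun=> x).
  by move=> W _; apply: ideal_sum => // i _; rewrite -mulrA; apply: idealM.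
have := bP setT; rewrite cardsT card_ord => /(_ erefl).
by rewrite /koszul big1 ?subr0 // => i; rewrite inE.
Qed.

(** With M = R/J, this is exactness of H_{j+1}(M) -> H_{j+1}(M/s) -> H_j(M), by an explicit diagram
    chase. *)
Lemma koszul_exact_adjoin J s j : is_ideal J -> regular_mod J s ->
  koszul_exact J j.+1 -> koszul_exact J j -> koszul_exact (adjoin J s) j.+1.
Proof.
move=> iJ reg_s exS ex c cycle_c.
have /choice [b bP] W : exists x, #|W| = j -> J (koszul c W - x * s).
  have [Wj|nWj] := pselect (#|W| = j); last by exists 0.
  by have [|x Jx] := cycle_c W; [rewrite Wj | exists x].
(* The connecting map sends [c] to [b], the quotient of its differential by [s]; regularity of [s]
   makes [b] a cycle. *)
have [|e eP] := ex b.
  move=> W Wj; apply: reg_s; rewrite -koszulZ.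
  have := @koszul_ideal J #|W| (fun U => koszul c U - s * b U) W iJ.
  rewrite koszulB koszul_koszul sub0r => Jd.
  rewrite -[koszul _ _]opprK; apply: idealN => //; apply: Jd => // U Uj.
  by rewrite mulrC; apply: bP; rewrite Uj.
have [|f fP] := exS (fun U => c U - s * e U).
  move=> W [Wj]; rewrite koszulB koszulZ.
  have -> : koszul c W - s * koszul e W =
    (koszul c W - b W * s) + s * (b W - koszul e W) by ring.
  by apply: idealD => //; [apply: bP | apply: idealM => //; apply: eP].
exists f => U Uj; exists (e U).
by rewrite mulrC addrAC; apply: fP.
Qed.

(** Exactness of H_{j+1}(M/s) -> H_j(M) -> H_j(M), the last map being multiplication by [s], makes
    [s] injective on H_j(M). It is also nilpotent there, since every [theta i] acts as 0. *)
Lemma koszul_exact_descend J s j N : is_ideal J -> regular_mod J s ->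
  in_ideal (codom theta) (s ^+ N) ->
  koszul_exact (adjoin J s) j.+1 -> koszul_exact J j.
Proof.
move=> iJ reg_s sN exS c cycle_c.
(* The annihilator of the homology class of [c]. It contains the [theta i], hence [s ^+ N], and the
   power is then lowered to 0. *)
pose bounded r := exists b, forall U, #|U| = j -> J (r * c U - koszul b U).
have s_inj n : bounded (s ^+ n.+1) -> bounded (s ^+ n).
  case=> b bP; have [|e eP] := exS b.
    move=> W [Wj]; exists (s ^+ n * c W).
    have -> : koszul b W - s ^+ n * c W * s = - (s ^+ n.+1 * c W - koszul b W).
      by rewrite exprS; ring.
    by apply: idealN => //; apply: bP.
  have /choice [f fP] U : exists x, #|U| = j.+1 -> J (b U - koszul e U - x * s).
    have [Uj|nUj] := pselect (#|U| = j.+1); last by exists 0.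
    by have [x Jx] := eP U Uj; exists x.
  exists f => U Uj; apply: reg_s.
  have Jd : J (koszul b U - s * koszul f U).
    have := @koszul_ideal J j (fun U => (b U - koszul e U) - s * f U) U iJ.
    rewrite !koszulB koszulZ koszul_koszul subr0; apply=> // V Vj.
    by rewrite mulrC; apply: fP.
  have -> : s * (s ^+ n * c U - koszul f U) =
    (s ^+ n.+1 * c U - koszul b U) + (koszul b U - s * koszul f U).
    by rewrite exprS; ring.
  by apply: idealD => //; apply: bP.
have bounded_ideal : is_ideal bounded.
  split.
  - exists (fun=> 0) => U _; rewrite mul0r /koszul big1 ?subrr; last first.
      by move=> i _; rewrite mulr0.
    exact: ideal0.
  - move=> x y [b bP] [e eP]; exists (fun U => b U + e U) => U Uj.
    rewrite koszulD mulrDl opprD addrACA.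
    by apply: idealD => //; [apply: bP | apply: eP].
  - move=> a x [b bP]; exists (fun U => a * b U) => U Uj.
    by rewrite koszulZ -mulrA -mulrBr; apply: idealM => //; apply: bP.
have bounded_theta r : r \in codom theta -> bounded r.
  (* With [delta] the identity, the homotopy formula gives [theta i * c U] on both branches. *)
  case/codomP => i ->; exists (koszul_homotopy idfun i c) => U Uj.
  have := @koszul_homotopyE idfun i c U (fun _ _ _ => erefl).
  rewrite if_same => <-; rewrite addrAC subrr add0r /koszul_homotopy.
  case: ifP => iU; last exact: ideal0.
  by apply: idealM => //; apply: cycle_c; rewrite -Uj (cardsD1 i U) iU.
have bN : bounded (s ^+ N) by apply: in_ideal_min bounded_ideal _ sN.
have [b bP] : bounded (s ^+ 0) by elim: N bN {sN} => // n IHn /s_inj.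
by exists b => U /bP; rewrite mul1r.
Qed.

End Koszul.

(** * Depth sensitivity of the Koszul complex *)

Section DepthSensitivity.

Variables (R : comNzRingType) (d : nat) (theta : 'I_d -> R) (m : seq R).
Hypothesis noethR : noetherian R.
Hypothesis m1 : ~ in_ideal m 1.
Hypothesis theta_m : forall i, in_ideal m (theta i).
Hypothesis m_rad : forall r, in_ideal m r ->
  exists N, in_ideal (codom theta) (r ^+ N).

Lemma in_ideal_rconsE (s : seq R) x :
  in_ideal (rcons s x) = adjoin (in_ideal s) x.
Proof. by apply/funext => r; apply/propext/in_ideal_rcons. Qed.

(** Downward induction on [i]: modulo the whole sequence the range is j > d, and each element
    removed extends it down by one degree. *)
Lemma koszul_exact_regular_sequence (s : seq R) i j :
  regular_sequence s -> (forall r, r \in s -> in_ideal m r) ->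
  (i <= size s)%N -> (d + i < j + size s)%N ->
  koszul_exact theta (in_ideal (take i s)) j.
Proof.
move=> [reg_s _] sm.
elim: {i}(size s - i)%N {-2}i (erefl (size s - i)%N) j => [|e IHe] i Ei j le_is.
  by move=> dj; apply: koszul_exact_large; lia.
move=> dj; have lt_is : (i < size s)%N by lia.
have [N sN] := m_rad (sm _ (mem_nth 0 lt_is)).
apply: koszul_exact_descend (in_ideal_is_ideal _) (reg_s i lt_is) sN _.
by rewrite -in_ideal_rconsE -take_nth //; apply: IHe; lia.
Qed.

(** Each regular element added raises by one the degree above which homology vanishes. While r < n,
    degree d is still above it, so prime avoidance yields another element. *)
Lemma regular_sequence_exists n r :
  (n <= d)%N -> (forall j, (d - n < j)%N -> koszul_exact theta (in_ideal [::]) j) ->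
  (r <= n)%N ->
  exists s : seq R, [/\ regular_sequence s, forall x, x \in s -> in_ideal m x,
    size s = r & forall j, (d - n + r < j)%N -> koszul_exact theta (in_ideal s) j].
Proof.
move=> nd ex0; elim: r => [|r IHr] rn.
  exists [::]; split=> //; last by move=> j dj; apply: ex0; lia.
  by split=> // /in_ideal_nil /eqP; rewrite oner_eq0.
have [s [[reg_s _] sm sr ex_s]] := IHr (ltnW rn).
have ids := in_ideal_is_ideal s.
have [|x xm reg_x] := exists_regular noethR ids (m := m).
  move=> c nc; apply: contrapT => /forall2NP socle; apply: nc.
  apply: (koszul_exact_top (theta := theta)) => // [|i].
    by apply: ex_s; lia.
  by case: (socle (theta i)) => [[]//|/contrapT].
have sxm y : y \in rcons s x -> in_ideal m y.
  by rewrite mem_rcons inE => /predU1P [->|/sm].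
exists (rcons s x); split=> //; first split.
- move=> i; rewrite size_rcons ltnS leq_eqVlt nth_rcons => /predU1P [->|lt_is].
    by rewrite ltnn eqxx -cats1 take_size_cat.
  by rewrite lt_is -cats1 takel_cat ?(ltnW lt_is) //; apply: reg_s.
- by apply: contra_not m1; apply: in_ideal_min => //; apply: in_ideal_is_ideal.
- by rewrite size_rcons sr.
- move=> [//|j] dj; rewrite in_ideal_rconsE.
  by apply: koszul_exact_adjoin => //; apply: ex_s; lia.
Qed.

(** A regular sequence longer than [n] would force homology to vanish in degree d - n as well. *)
Lemma koszul_is_depth n : (n <= d)%N ->
  (forall j, (d - n < j)%N -> koszul_exact theta (in_ideal [::]) j) ->
  ~ koszul_exact theta (in_ideal [::]) (d - n) ->
  is_depth m n.
Proof.
move=> nd ex0 nex; split.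
  by have [s [reg_s sm sn _]] := regular_sequence_exists nd ex0 (leqnn n); exists s.
move=> s reg_s sm; rewrite leqNgt; apply/negP => lt_ns; apply: nex.
have := @koszul_exact_regular_sequence s 0 (d - n) reg_s sm isT.
by rewrite take0; apply; lia.
Qed.

End DepthSensitivity.

(** * Reduced homology and cohomology *)

Section Cohomology.

Variables (k : fieldType) (V : finType).
Implicit Types (K : {set {set V}}) (F G : {set V}) (z : chain k V)
  (phi psi : {set V} -> k).

(** Cochains are functions on all vertex sets; a complex and a degree enter only through the sets at
    which an equation is required. *)
Definition coboundary phi F : k :=
  \sum_(v in F) (-1) ^+ vertex_pos F v * phi (F :\ v).

Definition pairing phi z : k^o := \sum_F phi F * z F.

Lemma pairing_is_linear phi : linear (pairing phi).
Proof.
move=> a x y; rewrite /pairing scaler_sumr -big_split /=.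
by apply: eq_bigr => F _; rewrite !ffunE mulrDr mulrCA.
Qed.

HB.instance Definition _ phi :=
  GRing.isLinear.Build k (chain k V) k^o *:%R (pairing phi)
    (pairing_is_linear phi).

Lemma pairing_basic phi F : pairing phi (basic_chain k F) = phi F.
Proof.
rewrite /pairing (bigD1 F) //= ffunE eqxx mulr1 big1 ?addr0 // => G /negPf GF.
by rewrite ffunE GF mulr0.
Qed.

Lemma chain_sum z : z = \sum_F z F *: basic_chain k F.
Proof.
apply/ffunP => G; rewrite sum_ffunE (bigD1 G) //= big1 ?addr0 => [|F FG].
  by rewrite !ffunE eqxx [_ *: _]mulr1.
by rewrite !ffunE eq_sym (negPf FG) [_ *: _]mulr0.
Qed.

Lemma boundaryE z : boundary k V z = \sum_F z F *:
  \sum_(v in F) (-1) ^+ vertex_pos F v *: basic_chain k (F :\ v).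
Proof. exact: lfunE. Qed.

Lemma boundary_basic F : boundary k V (basic_chain k F) =
  \sum_(v in F) (-1) ^+ vertex_pos F v *: basic_chain k (F :\ v).
Proof.
rewrite boundaryE (bigD1 F) //= ffunE eqxx scale1r [X in _ + X]big1 ?addr0 // => G /negPf GF.
by rewrite ffunE GF scale0r.
Qed.

Lemma pairing_boundary phi z :
  pairing phi (boundary k V z) = pairing (coboundary phi) z.
Proof.
rewrite boundaryE linear_sum; apply: eq_bigr => F _.
rewrite linearZ /= mulrC; congr (_ * _); rewrite linear_sum /=.
by apply: eq_bigr => v _; rewrite linearZ /= pairing_basic.
Qed.

Lemma basic_in_chains K p F :
  F \in K -> #|F|%:Z - 1 = p -> basic_chain k F \in chains k K p.
Proof.
move=> FK Fp; apply: memv_span; apply: map_f.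
by rewrite mem_enum inE FK Fp eqxx.
Qed.

Lemma chains_support K p z F :
  z \in chains k K p -> z F != 0 -> F \in K /\ #|F|%:Z - 1 = p.
Proof.
move=> zC; apply: contra_neqP => nF.
pose s := [seq basic_chain k F | F in [set F in K | #|F|%:Z - 1 == p]].
rewrite (coord_span (X := in_tuple s) zC) sum_ffunE big1 // => i _.
have /mapP [G + sG] : s`_i \in s by apply: mem_nth.
rewrite ffunE /= sG => {sG}.
rewrite mem_enum inE => /andP [GK /eqP Gp]; rewrite ffunE.
by case: eqP => [FG|_]; [case: nF; rewrite FG | rewrite [_ *: _]mulr0].
Qed.

Lemma reduced_homology_neq0 K p :
  (exists h : reduced_homology k K p, h != 0) <->
  exists2 z, z \in cycles k K p & z \notin boundaries k K p.
Proof.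
split=> [[h hn0]|[z zZ zB]].
  exists (vsval (repr h)); first exact: subvsP.
  apply: contra hn0 => hB.
  have : repr h - 0 \in @boundary_cycles k V K p by rewrite subr0.
  by rewrite Quotient.idealrBE reprK piE.
pose Q := Quotient.quot (@boundary_cycles k V K p).
exists (\pi_Q (Subvs zZ))%qT; apply: contra zB => /eqP h0.
have : Subvs zZ - 0 \in @boundary_cycles k V K p.
  by rewrite Quotient.idealrBE h0; apply/eqP; rewrite !piE.
by rewrite subr0 unfold_in.
Qed.

Lemma pairing_eq0 phi z : (forall F, z F != 0 -> phi F = 0) -> pairing phi z = 0.
Proof.
move=> zphi; rewrite /pairing big1 // => F _.
by have [->|/zphi ->] := eqVneq (z F) 0; rewrite ?mulr0 ?mul0r.
Qed.

Lemma card_dim i F : #|F|%:Z - 1 = i%:Z - 1 <-> #|F| = i.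
Proof. by split=> [|->//]; lia. Qed.

(** Duality over a field: a functional that vanishes on cycles factors through the boundary map, and
    a cycle that is not a boundary is detected by a functional that vanishes on boundaries. *)
Lemma homology_cohomology K i :
  (forall z, z \in cycles k K (i%:Z - 1) -> z \in boundaries k K (i%:Z - 1)) <->
  (forall phi, (forall F, F \in K -> #|F| = i.+1 -> coboundary phi F = 0) ->
    exists psi, forall F, F \in K -> #|F| = i -> phi F = coboundary psi F).
Proof.
have dimS : i%:Z - 1 + 1 = i.+1%:Z - 1 by lia.
split=> [exK phi dphi|exK z].
  pose C := chains k K (i%:Z - 1).
  pose f := (boundary k V \o projv C)%VF.
  (* The generalized inverse of [f] chooses preimages under the boundary on [C]. Two choices differ
     by a cycle, that is by a boundary, on which [phi] vanishes. *)
  pose psi G := pairing phi (projv C ((f^-1)%VF (basic_chain k G))).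
  exists psi => F FK Fi.
  have FC : basic_chain k F \in C by apply: basic_in_chains => //; apply/card_dim.
  have fF : f (basic_chain k F) = boundary k V (basic_chain k F).
    by rewrite comp_lfunE projv_id.
  pose x := basic_chain k F - (f^-1)%VF (f (basic_chain k F)).
  have fx : f x = 0 by rewrite linearB /= limg_lfunVK ?subrr ?memv_img ?memvf.
  have xZ : projv C x \in cycles k K (i%:Z - 1).
    by rewrite memv_cap memv_proj memv_ker -fx comp_lfunE eqxx.
  have /memv_imgP [y yC xy] := exK _ xZ.
  have : pairing phi (projv C x) = 0.
    rewrite xy pairing_boundary; apply: pairing_eq0 => G yG.
    have [GK] := chains_support yC yG.
    by rewrite dimS => /card_dim; apply: dphi.
  rewrite !linearB /= projv_id // pairing_basic => /eqP; rewrite subr_eq0 => /eqP ->.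
  rewrite fF boundary_basic !linear_sum; apply: eq_bigr => v _.
  by rewrite !linearZ.
set B := boundaries k K _; rewrite memv_cap memv_ker => /andP [zC /eqP dz].
apply: contrapT => /negP zB.
have [G wG] : exists G, (z - projv B z) G != 0.
  apply: contrapT => /forallNP w0; move/negP: zB; apply.
  have -> : z = projv B z; last exact: memv_proj.
  apply/eqP; rewrite -subr_eq0; apply/eqP/ffunP => G; rewrite [RHS]ffunE.
  by apply/eqP; have /negP := w0 G; rewrite negbK.
pose P := (\1 - projv B)%VF.
have PE x : P x = x - projv B x by rewrite add_lfunE opp_lfunE id_lfunE.
(* A coordinate of the projection along the boundaries, taken at a [G] where it is nonzero on
   [z]. *)
pose phi F := P (basic_chain k F) G.
have phiP x : P x G = pairing phi x.
  rewrite {1}[x]chain_sum linear_sum sum_ffunE; apply: eq_bigr => F _.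
  by rewrite linearZ ffunE mulrC.
have [F FK Fi|psi psiP] := exK phi.
  rewrite -pairing_basic -pairing_boundary -phiP PE projv_id ?subrr ?ffunE //.
  apply: memv_img; rewrite dimS; apply: basic_in_chains => //.
  exact/card_dim.
move/eqP: wG; apply; rewrite -PE phiP.
transitivity (pairing (coboundary psi) z).
  apply: eq_bigr => F _; have [->|/(chains_support zC) [FK]] := eqVneq (z F) 0.
    by rewrite !mulr0.
  by move/card_dim => /(psiP F FK) ->.
by rewrite -pairing_boundary dz linear0.
Qed.

End Cohomology.

(** * Shuffle signs *)

Section Signs.

Variables (V : finType) (d : nat) (kappa : V -> 'I_d).
Implicit Types (F : {set V}) (T : {set 'I_d}) (v : V).

Definition below T (i : 'I_d) : nat := #|[set j in T | (j < i)%N]|.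

Definition inversions F : nat :=
  \sum_(u in F) \sum_(w in F)
    ((enum_rank u < enum_rank w)%N && (kappa w < kappa u)%N).

(** The first summand sorts [F] by colour, the second moves its colours in front of the rest of [T].
    The second also counts the pairs of colours inside [F], which avoids a sign depending on the
    size of [F]. *)
Definition shuffle_exp T F : nat :=
  inversions F + \sum_(w in F) below T (kappa w).

Lemma card_setIdE (I : finType) (A : {set I}) (P : pred I) :
  #|[set x in A | P x]| = (\sum_(x in A) P x)%N.
Proof.
rewrite -sum1_card big_mkcond [RHS]big_mkcond; apply: eq_bigr => x _.
by rewrite inE; case: (x \in A); case: (P x).
Qed.

Lemma inversionsD1 F v : v \in F -> inversions F =
  (\sum_(w in F :\ v) ((enum_rank v < enum_rank w)%N && (kappa w < kappa v)%N)
   + \sum_(w in F :\ v) ((enum_rank w < enum_rank v)%N && (kappa v < kappa w)%N)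
   + inversions (F :\ v))%N.
Proof.
move=> vF; rewrite /inversions (big_setD1 v vF) //= (big_setD1 v vF) //= !ltnn add0n.
rewrite -addnA; congr (_ + _)%N; rewrite -big_split; apply: eq_bigr => u _.
by rewrite (big_setD1 v vF) //=.
Qed.

(** This turns the Koszul sign of the colour of [v] into the simplicial sign of [v]. Modulo 2, only
    the pairs that involve [v] remain. *)
Lemma shuffle_sign T F v : {in F &, injective kappa} ->
  kappa @: F \subset T -> v \in F ->
  odd (shuffle_exp T F + below (T :\: kappa @: F) (kappa v)
       + shuffle_exp T (F :\ v)) = odd (vertex_pos F v).
Proof.
move=> injF sFT vF; rewrite /shuffle_exp (inversionsD1 vF) (big_setD1 v vF) //=.
have -> : below T (kappa v) = (below (T :\: kappa @: F) (kappa v)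
    + \sum_(w in F :\ v) (kappa w < kappa v))%N.
  rewrite /below !card_setIdE (big_setID (kappa @: F)) /= addnC; congr (_ + _)%N.
  rewrite (setIidPr sFT) big_imset //= [LHS](big_setD1 v vF) //= ltnn.
  exact: add0n.
have -> : vertex_pos F v = (\sum_(w in F :\ v) (enum_rank w < enum_rank v))%N.
  by rewrite /vertex_pos card_setIdE (big_setD1 v vF) //= ltnn.
set A := (\sum_(w in F :\ v) (_ && (kappa w < kappa v)))%N.
set B := (\sum_(w in F :\ v) (_ && (kappa v < kappa w)))%N.
set X := (\sum_(w in F :\ v) (kappa w < kappa v))%N.
set P := (\sum_(w in F :\ v) (enum_rank w < enum_rank v))%N.
(* Checked for each [w] separately, in the four cases of its position and colour relative to [v]. *)
have ABXP : (A + B + X = P + A + A)%N.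
  rewrite -!big_split; apply: eq_bigr => w; rewrite !inE => /andP [wv wF] /=.
  have kwv : kappa w != kappa v by apply: contra_neq wv; apply: injF.
  have rwv : enum_rank w != enum_rank v by rewrite (inj_eq enum_rank_inj).
  have := kwv; have := rwv; rewrite -!val_eqE /=.
  by case: (ltngtP (kappa w) (kappa v));
     case: (ltngtP (enum_rank w) (enum_rank v)).
by lia.
Qed.

End Signs.

(** * The Koszul complex of the colour parameters *)

Section StanleyReisnerKoszul.

Variables (k : fieldType) (V : finType) (D : simplicial_complex V).
Variables (d : nat) (kappa : V -> 'I_d).
Hypothesis kappaP : forall F, F \in faces D -> {in F &, injective kappa}.

Local Notation S := {mpoly k[#|V|]}.
Local Notation mon := 'X_{1..#|V|}.
Implicit Types (m : mon) (p : S) (F G : {set V}) (v : V) (T U W : {set 'I_d}).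

(** * Monomials indexed by vertices, and the Stanley-Reisner ideal *)

Definition mono_exp m v : nat := m (enum_rank v).

Definition mono_var v : mon := U_(enum_rank v)%MM.

Definition mono_supp m : {set V} := [set v | mono_exp m v != 0%N].

Definition set_mono F : mon := [multinom (enum_val i \in F : nat) | i < #|V|].

Definition face_mono m := mono_supp m \in faces D.

Lemma mono_expD m1 m2 v :
  mono_exp (m1 + m2)%MM v = (mono_exp m1 v + mono_exp m2 v)%N.
Proof. exact: mnmDE. Qed.

Lemma mono_expB m1 m2 v :
  mono_exp (m1 - m2)%MM v = (mono_exp m1 v - mono_exp m2 v)%N.
Proof. exact: mnmBE. Qed.

Lemma mono_exp_var u v : mono_exp (mono_var u) v = (u == v) :> nat.
Proof. by rewrite /mono_exp mnm1E (inj_eq enum_rank_inj). Qed.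

Lemma mono_exp_set F v : mono_exp (set_mono F) v = (v \in F) :> nat.
Proof. by rewrite /mono_exp mnmE enum_rankK. Qed.

Definition mono_expE := (mono_expD, mono_expB, mono_exp_var, mono_exp_set).

Lemma mem_mono_supp m v : (v \in mono_supp m) = (0 < mono_exp m v)%N.
Proof. by rewrite inE lt0n. Qed.

Lemma monoP m m' : (forall v, mono_exp m v = mono_exp m' v) -> m = m'.
Proof. by move=> mm'; apply/mnmP => i; rewrite -[i]enum_valK; apply: mm'. Qed.

Lemma mono_leP m m' :
  reflect (forall v, (mono_exp m v <= mono_exp m' v)%N) (m <= m')%MM.
Proof.
apply: (iffP mnm_lepP) => [le_mm' v|le_mm' i]; first exact: le_mm'.
by rewrite -[i]enum_valK; apply: le_mm'.
Qed.

Lemma mono_var_le v m : (mono_var v <= m)%MM = (0 < mono_exp m v)%N.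
Proof. by rewrite lep1mP lt0n. Qed.

Lemma mono_supp_set F : mono_supp (set_mono F) = F.
Proof. by apply/setP => v; rewrite mem_mono_supp mono_expE; case: (v \in F). Qed.

Lemma set_mono_prod F :
  \prod_(v in F) vertex_var k v = 'X_[set_mono F].
Proof.
rewrite mprodXE; congr 'X_[_]; apply: monoP => v.
rewrite mono_exp_set /mono_exp mnm_sumE.
rewrite (eq_bigr (fun u => nat_of_bool (u == v))) => [|u _]; last first.
  exact: mono_exp_var.
have [vF|nvF] := boolP (v \in F).
  by rewrite (bigD1 v) //= eqxx big1 // => u /andP [_ /negPf ->].
by rewrite big1 // => u uF; case: eqP nvF => // <-; rewrite uF.
Qed.

Lemma face_monoS m m' : {subset mono_supp m <= mono_supp m'} ->
  face_mono m' -> face_mono m.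
Proof. by move=> mm'; apply/face_subset/subsetP. Qed.

Lemma face_coeffs_is_ideal : is_ideal (fun p => forall m, face_mono m -> p@_m = 0).
Proof.
split=> [m _|p q p0 q0 m mD|a p p0 m mD]; first exact: mcoeff0.
  by rewrite mcoeffD p0 // q0 // addr0.
rewrite mcoeffM big1 // => -[m1 m2] /= /eqP Em; rewrite p0 ?mulr0 //.
apply: face_monoS mD => v; rewrite !mem_mono_supp.
have /(congr1 (mono_exp ^~ v)) := Em; rewrite mono_expD => ->; lia.
Qed.

(** A monomial whose support is not a face is a multiple of the generator of its support.
    Congruences modulo the ideal can thus be checked coefficientwise at face monomials. *)
Lemma sr_idealP p : in_ideal (sr_generators k D) p <->
  forall m, face_mono m -> p@_m = 0.
Proof.
split=> [|p0].
  apply: (in_ideal_min face_coeffs_is_ideal) => q /imageP [F].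
  rewrite inE set_mono_prod => FD -> m; rewrite mcoeffX => mD.
  by case: eqP => // Em; move: mD; rewrite -Em /face_mono mono_supp_set (negPf FD).
rewrite [p]mpolyE big_seq; apply: ideal_sum => [|m]; first exact: in_ideal_is_ideal.
rewrite mcoeff_msupp => pm.
have mD : mono_supp m \notin D by apply: contra pm => /p0 /eqP.
have Em : m = (m - set_mono (mono_supp m) + set_mono (mono_supp m))%MM.
  rewrite submK //; apply/mono_leP => v.
  by rewrite mono_exp_set mem_mono_supp; case: (mono_exp _ _).
rewrite Em mpolyXD scalerAl; apply: idealM; first exact: in_ideal_is_ideal.
apply: mem_in_ideal; apply/imageP; exists (mono_supp m); first by rewrite inE.
by rewrite set_mono_prod.
Qed.

(** * Colour parameters and division by them *)

Definition theta (i : 'I_d) : S := \sum_(v | kappa v == i) vertex_var k v.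

Lemma mcoeff_varM v p m : (vertex_var k v * p)@_m =
  if v \in mono_supp m then p@_(m - mono_var v) else 0.
Proof.
rewrite mem_mono_supp; case: ifPn => mv.
  rewrite mulrC -{1}[m](submK (m := mono_var v)) ?mono_var_le //.
  by rewrite addmC mcoeffMX.
rewrite mulrC mcoeffM big1 // => -[m1 m2] /= /eqP Em.
rewrite mcoeffX; case: eqP => [Em2|]; rewrite ?mulr0 //.
have /(congr1 (mono_exp ^~ v)) := Em; rewrite mono_expD -Em2 mono_exp_var eqxx.
lia.
Qed.

Lemma mcoeff_theta i p m : (theta i * p)@_m =
  \sum_(v in mono_supp m | kappa v == i) p@_(m - mono_var v).
Proof.
rewrite mulr_suml raddf_sum /= big_mkcond [RHS]big_mkcond.
apply: eq_bigr => v _; rewrite mcoeff_varM andbC.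
by case: (kappa v == i) (v \in _) => -[].
Qed.

(** A face has at most one vertex of each colour, so sums over a colour collapse to one term. *)
Lemma big_color m v (A : V -> k) : face_mono m -> v \in mono_supp m ->
  \sum_(u in mono_supp m | kappa u == kappa v) A u = A v.
Proof.
move=> mD vm; rewrite (bigD1 v) ?vm ?eqxx //= big1 ?addr0 //.
move=> u /andP [/andP [um /eqP uv] /eqP []]; exact: kappaP mD _ _ um vm uv.
Qed.

(* Division by the variable of [v], dropping the monomials in which it has       *)
(* exponent at most 1 so that supports are preserved.                            *)
Definition shift v p : S :=
  \sum_(m <- msupp p | (1 < mono_exp m v)%N) p@_m *: 'X_[m - mono_var v].

Lemma mcoeff_shift v p m : (shift v p)@_m =
  if v \in mono_supp m then p@_(m + mono_var v) else 0.
Proof.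
rewrite /shift raddf_sum /= mem_mono_supp.
under eq_bigr do rewrite mcoeffZ mcoeffX.
case: ifPn => [mv|mv]; last first.
  rewrite big1 // => m' m'v; case: eqP => [Em|]; rewrite ?mulr0 //.
  by move: mv; rewrite -Em !mono_expE eqxx; lia.
have [mp|mp] := boolP ((m + mono_var v)%MM \in msupp p); last first.
  rewrite (memN_msupp_eq0 mp) big_seq_cond big1 // => m' /andP [m'p m'v].
  case: eqP => [Em|]; rewrite ?mulr0 //; case/negP: mp.
  by rewrite -Em submK // mono_var_le; lia.
rewrite big_mkcond (bigD1_seq (m + mono_var v)%MM) ?msupp_uniq //=.
rewrite addmK eqxx mulr1 !mono_expE eqxx big1 ?addr0 => [|m' /eqP nm'].
  by rewrite ifT //; lia.
case: ifP => // m'v; case: eqP => [Em|]; rewrite ?mulr0 //.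
by case: nm'; rewrite -Em submK // mono_var_le; lia.
Qed.

Definition delta i p : S := \sum_(v | kappa v == i) shift v p.

Lemma mcoeff_delta i p m : (delta i p)@_m =
  \sum_(v in mono_supp m | kappa v == i) p@_(m + mono_var v).
Proof.
rewrite raddf_sum /= big_mkcond [RHS]big_mkcond.
apply: eq_bigr => v _; rewrite mcoeff_shift andbC.
by case: (kappa v == i) (v \in _) => -[].
Qed.

Lemma delta_is_zmod_morphism i : zmod_morphism (delta i).
Proof.
move=> p q; apply/mpolyP => m; rewrite mcoeffB !mcoeff_delta -sumrB.
by apply: eq_bigr => v _; rewrite mcoeffB.
Qed.

HB.instance Definition _ i :=
  GRing.isZmodMorphism.Build S S (delta i) (delta_is_zmod_morphism i).

Lemma shift_varM u v p : u != v ->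
  shift v (vertex_var k u * p) = vertex_var k u * shift v p.
Proof.
move=> uv; apply/mpolyP => m; rewrite !(mcoeff_shift, mcoeff_varM).
rewrite !mem_mono_supp !mono_expE [v == u]eq_sym (negPf uv) addn0 subn0.
case: ifP => // mv; case: ifP => // mu; congr (p@__).
apply: monoP => w; rewrite !mono_expE.
have : ~~ ((u == w) && (v == w)).
  by apply: contra uv => /andP [/eqP -> /eqP ->].
by case: (u == w); case: (v == w) => //= _; lia.
Qed.

Lemma delta_thetaM i l p : l != i -> delta i (theta l * p) = theta l * delta i p.
Proof.
move=> li; rewrite /delta mulr_sumr; apply: eq_bigr => v /eqP vi.
apply/mpolyP => m; rewrite mcoeff_shift mcoeff_theta mulr_suml.
transitivity (\sum_(u | kappa u == l) (shift v (vertex_var k u * p))@_m); last first.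
  rewrite raddf_sum /=; apply: eq_bigr => u /eqP ul; rewrite shift_varM //.
  by apply: contra_neq li => uv; rewrite -ul uv vi.
under [RHS]eq_bigr do rewrite mcoeff_shift.
case: ifP => mv; last by rewrite big1.
under [RHS]eq_bigr do rewrite mcoeff_varM.
rewrite -big_mkcondr; apply: eq_bigl => u; exact: andbC.
Qed.

Local Notation J := (in_ideal (sr_generators k D)).
Implicit Types (c b : {set 'I_d} -> S).

Let idJ : is_ideal J := in_ideal_is_ideal _.

(** Multiplying a face monomial by a variable of its own support keeps the support, so [delta]
    passes to k[D]. *)
Lemma delta_ideal i p : J p -> J (delta i p).
Proof.
move=> /sr_idealP p0; apply/sr_idealP => m mD.
rewrite mcoeff_delta big1 // => v /andP [vm _]; apply: p0.
apply: face_monoS mD => u; move: vm; rewrite !mem_mono_supp !mono_expE.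
by case: eqP => [->|_]; lia.
Qed.

(** For a face monomial [m], this says that m e_U has degree at most 1 in colour [i], where e_i has
    degree 1. *)
Definition reduced_at i U m := if i \in U then i \notin kappa @: mono_supp m
  else [forall v in mono_supp m, (kappa v == i) ==> (mono_exp m v == 1%N)].

Lemma color_vertex i m : i \in kappa @: mono_supp m ->
  exists2 v, v \in mono_supp m & kappa v = i.
Proof. by case/imsetP => v vm ->; exists v. Qed.

Lemma big_no_color i m (A : V -> k) : i \notin kappa @: mono_supp m ->
  \sum_(u in mono_supp m | kappa u == i) A u = 0.
Proof.
move=> im; rewrite big1 // => u /andP [um /eqP ui].
by case/negP: im; rewrite -ui imset_f.
Qed.

(** In colour [i] a face monomial is a power x_v^a. This composite is the identity for a >= 1 and 0
    for a = 0; in the opposite order the threshold is a >= 2. *)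
Lemma mcoeff_delta_theta i p m : face_mono m ->
  (delta i (theta i * p))@_m = if i \in kappa @: mono_supp m then p@_m else 0.
Proof.
move=> mD; rewrite mcoeff_delta.
case: ifPn => [/color_vertex [v vm <-]|/big_no_color -> //].
rewrite big_color // mcoeff_theta big_color ?addmK //.
  apply: face_monoS mD => u; move: vm; rewrite !mem_mono_supp !mono_expE.
  by case: eqP => [->|_]; lia.
by move: vm; rewrite !mem_mono_supp mono_expD; lia.
Qed.

Lemma mcoeff_theta_delta i p m : face_mono m ->
  (theta i * delta i p)@_m =
  if [forall v in mono_supp m, (kappa v == i) ==> (mono_exp m v == 1%N)]
  then 0 else p@_m.
Proof.
move=> mD; rewrite mcoeff_theta.
have [/color_vertex [v vm <-]|im] := boolP (i \in kappa @: mono_supp m); last first.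
  rewrite big_no_color // ifT //; apply/forall_inP => v vm.
  by apply/implyP => /eqP vi; case/negP: im; rewrite -vi imset_f.
have mvD : face_mono (m - mono_var v)%MM.
  by apply: face_monoS mD => u; rewrite !mem_mono_supp mono_expB; lia.
rewrite big_color // mcoeff_delta; case: ifPn => [/forall_inP red|nred].
  rewrite big1 // => u /andP [+ /eqP uv].
  move: (red v vm); rewrite eqxx /= !mem_mono_supp !mono_expE => /eqP mv mu.
  have um : u \in mono_supp m by rewrite mem_mono_supp; lia.
  by move: mu; rewrite (kappaP mD um vm uv) mv eqxx.
have mv : v \in mono_supp (m - mono_var v)%MM.
  move: nred => /forall_inPn [u um]; rewrite negb_imply => /andP [/eqP uv].
  have -> := kappaP mD um vm uv.
  by move: vm; rewrite !mem_mono_supp !mono_expE eqxx; lia.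
by rewrite big_color // submK // mono_var_le -mem_mono_supp.
Qed.

(* Subtracting [koszul_homotopy (delta i) i] from the identity kills the part of *)
(* degree at least 2 in the colour [i], counting [i \in U] as degree 1.          *)
Definition reduce_at i c U : S :=
  c U - (if i \in U then delta i (theta i * c U) else theta i * delta i (c U)).

Lemma mcoeff_reduce_at i c U m : face_mono m ->
  (reduce_at i c U)@_m = if reduced_at i U m then (c U)@_m else 0.
Proof.
move=> mD; rewrite /reduce_at /reduced_at mcoeffB; case: ifP => iU.
  by rewrite mcoeff_delta_theta //; case: ifP; rewrite ?subrr ?subr0.
by rewrite mcoeff_theta_delta //; case: ifP; rewrite ?subrr ?subr0.
Qed.

(** * Reduction to squarefree colour degrees *)

Definition cycle_mod j c := forall W, #|W|.+1 = j -> J (koszul theta c W).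

Definition homologous j c c' :=
  exists b, forall U, #|U| = j -> J (c U - c' U - koszul theta b U).

(** By the homotopy formula, [c] and its reduction differ by a boundary plus the homotopy of the
    differential of [c], which lies in [J] because [c] is a cycle. *)
Lemma reduce_at_homologous i j c : cycle_mod j c ->
  cycle_mod j (reduce_at i c) /\ homologous j c (reduce_at i c).
Proof.
move=> cycle_c; pose h := koszul_homotopy (delta i) i.
have hJ U : #|U| = j -> J (h (koszul theta c) U).
  move=> Uj; rewrite /h /koszul_homotopy; case: ifP => iU; last exact: ideal0.
  apply: idealM => //; apply/delta_ideal/cycle_c.
  by rewrite -Uj (cardsD1 i U) iU.
have redE U : reduce_at i c U =
    c U - (koszul theta (h c) U + h (koszul theta c) U).
  rewrite koszul_homotopyE // => l r li; exact: delta_thetaM.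
split=> [W Wj|].
  under [reduce_at i c]funext do rewrite redE.
  rewrite koszulB koszulD koszul_koszul add0r; apply: idealB => //.
    exact: cycle_c.
  by apply: (@koszul_ideal _ _ theta J #|W|) => // U Uj; apply: hJ; rewrite Uj.
exists (h c) => U Uj; rewrite redE.
have -> : c U - (c U - (koszul theta (h c) U + h (koszul theta c) U))
  - koszul theta (h c) U = h (koszul theta c) U by ring.
exact: hJ.
Qed.

Definition is_squarefree c := forall U m, face_mono m -> (c U)@_m != 0 ->
  m = set_mono (mono_supp m) /\ [disjoint kappa @: mono_supp m & U].

(** Reduce in one colour after another. At face monomials a reduction only deletes coefficients, so
    it preserves the earlier ones. *)
Lemma squarefree_homologous j c : cycle_mod j c ->
  exists c', [/\ is_squarefree c', cycle_mod j c' & homologous j c c'].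
Proof.
move=> cycle_c.
have [c' [c'red cycle_c' c'hom]] : exists c', [/\ forall U m, face_mono m ->
    (c' U)@_m != 0 -> forall i, i \in enum 'I_d -> reduced_at i U m,
    cycle_mod j c' & homologous j c c'].
  elim: (enum 'I_d) => [|i l [c' [c'red cycle_c' [b bP]]]].
    exists c; split=> //; exists (fun=> 0) => U _; rewrite subrr sub0r /koszul.
    by apply: idealN => //; apply: ideal_sum => // i _; rewrite mulr0; apply: ideal0.
  have [cycle_r [e eP]] := reduce_at_homologous i cycle_c'.
  exists (reduce_at i c'); split=> //.
    move=> U m mD; rewrite mcoeff_reduce_at //; case: ifP; rewrite ?eqxx //.
    move=> redi c'n0 i'; rewrite inE => /predU1P [->//|]; exact: c'red.
  exists (fun U => b U + e U) => U Uj; rewrite koszulD.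
  have -> : c U - reduce_at i c' U - (koszul theta b U + koszul theta e U) =
    (c U - c' U - koszul theta b U) + (c' U - reduce_at i c' U - koszul theta e U).
    by ring.
  by apply: idealD => //; [apply: bP | apply: eP].
exists c'; split=> // U m mD c'n0.
have red i : reduced_at i U m by apply: (c'red U m mD c'n0); rewrite mem_enum.
have disj : [disjoint kappa @: mono_supp m & U].
  apply/pred0P => i /=; apply/negP => /andP [im iU].
  by have := red i; rewrite /reduced_at iU im.
split=> //; apply: monoP => v; rewrite mono_exp_set.
have [vm|] := boolP (v \in mono_supp m); last by rewrite mem_mono_supp; lia.
have := red (kappa v); rewrite /reduced_at ifF.
  by move=> /forall_inP /(_ v vm); rewrite eqxx => /eqP.
by apply: (disjointFr disj); rewrite imset_f.
Qed.

(** * Squarefree chains as families of cochains *)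

Lemma mcoeff_signM n p m : ((-1) ^+ n * p)@_m = (-1) ^+ n * p@_m.
Proof. exact: raddfMsign. Qed.

Definition eta T F : k := (-1) ^+ shuffle_exp kappa T F.

Lemma etaK T F : eta T F * eta T F = 1.
Proof. by rewrite /eta -exprD addnn -mul2n exprM sqrrN expr1n expr1n. Qed.

Lemma eta_sign T F v : F \in faces D -> kappa @: F \subset T -> v \in F ->
  eta T F * (-1) ^+ below (T :\: kappa @: F) (kappa v) =
  (-1) ^+ vertex_pos F v * eta T (F :\ v).
Proof.
move=> FD sFT vF.
have <- : eta T F * (-1) ^+ below (T :\: kappa @: F) (kappa v) * eta T (F :\ v)
    = (-1) ^+ vertex_pos F v.
  rewrite /eta -!exprD -[LHS]signr_odd shuffle_sign ?signr_odd //; exact: kappaP.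
by rewrite -[RHS]mulrA etaK mulr1.
Qed.

(* The cochains of the colour-selected subcomplexes form the squarefree part of *)
(* the Koszul complex: [F] corresponds to the monomial of [F] in the component  *)
(* of index [T :\: kappa @: F], up to the sign of the shuffle that sorts the    *)
(* vertices of [F] by colour.                                                   *)
Definition cochain_of c T F : k :=
  eta T F * (c (T :\: kappa @: F))@_(set_mono F).

(** The inverse of [cochain_of]. The colour set is recovered as [kappa @: F :|: U], so one chain
    carries the cochains for all colour sets. *)
Definition squarefree_chain (g : {set 'I_d} -> {set V} -> k) U : S :=
  \sum_(F in faces D | [disjoint kappa @: F & U])
    (eta (kappa @: F :|: U) F * g (kappa @: F :|: U) F) *: 'X_[set_mono F].

Lemma cochain_of_eq c c' T F : F \in faces D ->
  J (c (T :\: kappa @: F) - c' (T :\: kappa @: F)) ->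
  cochain_of c T F = cochain_of c' T F.
Proof.
move=> FD /sr_idealP /(_ (set_mono F)); rewrite /face_mono mono_supp_set.
by move=> /(_ FD) /eqP; rewrite mcoeffB subr_eq0 /cochain_of => /eqP ->.
Qed.

Lemma set_monoD1 F v : v \in F ->
  (set_mono F - mono_var v)%MM = set_mono (F :\ v).
Proof.
move=> vF; apply: monoP => w; rewrite !mono_expE in_setD1 [v == w]eq_sym.
by case: (eqVneq w v) => [->|]; rewrite ?vF ?subn0.
Qed.

Lemma imset_setD1 F v : F \in faces D -> v \in F ->
  kappa @: (F :\ v) = (kappa @: F) :\ kappa v.
Proof.
move=> FD vF; apply/setP => i; rewrite in_setD1.
apply/imsetP/andP => [[u + ->]|[iv /imsetP [u uF Ei]]].
  rewrite in_setD1 => /andP [uv uF]; rewrite imset_f //; split=> //.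
  by apply: contra_neq uv; apply: kappaP FD _ _ uF vF.
by exists u => //; rewrite in_setD1 uF andbT; apply: contra_neq iv => <-.
Qed.

(** The sum over colours outside [W] becomes a sum over the vertices of [F], as colours absent from
    [F] contribute 0; [eta_sign] matches the signs. *)
Lemma cochain_of_koszul b T F : F \in faces D -> kappa @: F \subset T ->
  cochain_of (koszul theta b) T F = coboundary (cochain_of b T) F.
Proof.
move=> FD sFT; rewrite /cochain_of /coboundary; set W := T :\: kappa @: F.
have -> : (koszul theta b W)@_(set_mono F) = \sum_(v in F)
    (-1) ^+ below W (kappa v) * (b (kappa v |: W))@_(set_mono (F :\ v)).
  rewrite [RHS](partition_big kappa (fun i => i \notin W)) => /=; last first.
    by move=> v vF; rewrite inE imset_f.
  rewrite /koszul raddf_sum; apply: eq_bigr => i _ /=.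
  rewrite -mulrA mcoeff_signM -/(below W i) mcoeff_theta mono_supp_set.
  rewrite mulr_sumr; apply: eq_bigr => v /andP [vF /eqP <-].
  by rewrite set_monoD1.
rewrite mulr_sumr; apply: eq_bigr => v vF.
rewrite mulrA eta_sign // -mulrA imset_setD1 //; congr (_ * (_ * (b _)@__)).
apply/setP => i; rewrite !inE; case: eqP => // ->.
by rewrite (subsetP sFT) ?imset_f.
Qed.

Lemma mcoeff_squarefree_chain g U m : face_mono m ->
  (squarefree_chain g U)@_m =
  if (m == set_mono (mono_supp m)) && [disjoint kappa @: mono_supp m & U]
  then eta (kappa @: mono_supp m :|: U) (mono_supp m)
       * g (kappa @: mono_supp m :|: U) (mono_supp m)
  else 0.
Proof.
move=> mD; rewrite /squarefree_chain raddf_sum /=.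
under eq_bigr do rewrite mcoeffZ mcoeffX.
have eqF F : set_mono F = m -> F = mono_supp m by move=> <-; rewrite mono_supp_set.
case: ifPn => [/andP [/eqP Em disj]|nm].
  rewrite (bigD1 (mono_supp m)) ?[_ \in _]mD //= -Em eqxx mulr1 big1 ?addr0 //.
  move=> F /andP [_ nF]; case: eqP => [/eqF EF|]; rewrite ?mulr0 //.
  by rewrite EF eqxx in nF.
rewrite big1 // => F /andP [FD disj]; case: eqP => [EF|]; rewrite ?mulr0 //.
by case/negP: nm; rewrite -(eqF F EF) EF eqxx.
Qed.

Lemma squarefree_chain_is_squarefree g : is_squarefree (squarefree_chain g).
Proof.
move=> U m mD; rewrite mcoeff_squarefree_chain //.
by case: ifP => [/andP [/eqP]|]; rewrite ?eqxx.
Qed.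

Lemma cochain_of_squarefree_chain g T F : F \in faces D -> kappa @: F \subset T ->
  cochain_of (squarefree_chain g) T F = g T F.
Proof.
move=> FD sFT; rewrite /cochain_of mcoeff_squarefree_chain; last first.
  by rewrite /face_mono mono_supp_set.
rewrite mono_supp_set eqxx ifT /=.
  by rewrite setDE setUIr setUCr setIT (setUidPr sFT) mulrA etaK mul1r.
rewrite -setI_eq0; apply/eqP/setP => i; rewrite !inE.
by case: (i \in kappa @: F); rewrite ?andbF.
Qed.

Lemma squarefree_cochain c U : is_squarefree c ->
  J (c U - squarefree_chain (cochain_of c) U).
Proof.
move=> c_sf; apply/sr_idealP => m mD.
rewrite mcoeffB mcoeff_squarefree_chain //.
have [c0|cn0] := eqVneq (c U)@_m 0; last first.
  have [Em disj] := c_sf _ _ mD cn0; rewrite -Em eqxx disj /=.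
  rewrite /cochain_of -Em mulrA etaK mul1r setDUl setDv set0U.
  suff -> : U :\: kappa @: mono_supp m = U by rewrite subrr.
  by apply/setDidPl; rewrite disjoint_sym.
case: ifP => [/andP [/eqP Em disj]|]; last by rewrite c0 subrr.
rewrite /cochain_of -Em mulrA etaK mul1r setDUl setDv set0U.
suff -> : U :\: kappa @: mono_supp m = U by rewrite subrr.
by apply/setDidPl; rewrite disjoint_sym.
Qed.

(** The differential replaces e_i by a variable of colour [i], which keeps the colour degree. *)
Lemma koszul_squarefree b : is_squarefree b -> is_squarefree (koszul theta b).
Proof.
move=> b_sf W m mD; have [[i [v [iW vm vi bn0]]] _|nob] := pselect (exists i v,
    [/\ i \notin W, v \in mono_supp m, kappa v = i
      & (b (i |: W))@_(m - mono_var v) != 0]); last first.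
  rewrite /koszul raddf_sum big1 ?eqxx // => i iW /=.
  rewrite -mulrA mcoeff_signM mcoeff_theta big1 ?mulr0 // => v.
  case/andP=> vm /eqP vi; apply/eqP/negPn/negP => bn0.
  by apply: nob; exists i, v.
have mvD : face_mono (m - mono_var v)%MM.
  by apply: face_monoS mD => u; rewrite !mem_mono_supp mono_expB; lia.
have [Emv disj] := b_sf _ _ mvD bn0.
(* Colour [i] is already used by the index [i |: W], so x_v cannot divide the quotient of m by
   x_v. *)
have mv1 : mono_exp m v = 1%N.
  have : v \notin mono_supp (m - mono_var v)%MM.
    apply/negP => /(imset_f kappa); rewrite vi => iG.
    by have := disjointFr disj iG; rewrite setU11.
  by move: vm; rewrite !mem_mono_supp !mono_expE eqxx; lia.
split.
  apply: monoP => u; rewrite mono_exp_set mem_mono_supp.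
  have [<-|uv] := eqVneq v u; first by rewrite mv1.
  have := congr1 (mono_exp ^~ u) Emv.
  by rewrite mono_exp_set mem_mono_supp !mono_expE (negPf uv) subn0.
rewrite -setI_eq0; apply/eqP/setP => l; rewrite !inE.
apply/negP => /andP [/imsetP [u um ->] uW].
have [uv|uv] := eqVneq v u; first by case/negP: iW; rewrite -vi uv.
have uG : u \in mono_supp (m - mono_var v)%MM.
  by move: um; rewrite !mem_mono_supp !mono_expE (negPf uv) subn0.
by have := disjointFr disj (imset_f kappa uG); rewrite in_setU1 uW orbT.
Qed.

Lemma koszul_squarefree_chain psi U :
  J (koszul theta (squarefree_chain psi) U
     - squarefree_chain (fun T => coboundary (psi T)) U).
Proof.
have sf := koszul_squarefree (@squarefree_chain_is_squarefree psi).
have := squarefree_cochain U sf.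
suff -> : squarefree_chain (cochain_of (koszul theta (squarefree_chain psi))) U =
  squarefree_chain (fun T => coboundary (psi T)) U by [].
apply: eq_bigr => F /andP [FD disj]; congr (_ * _ *: _).
rewrite cochain_of_koszul ?subsetUl //; apply: eq_bigr => v vF; congr (_ * _).
rewrite cochain_of_squarefree_chain ?imset_setD1 //.
  by apply: face_subset FD; apply: subsetDl.
by apply: subset_trans (subsetDl _ _) (subsetUl _ _).
Qed.

(** Vanishing of the reduced cohomology, in degree i - 1, of the subcomplex of colours [T]; [i]
    counts vertices. *)
Definition cohomology_exact T i := forall phi : {set V} -> k,
  (forall F, F \in faces D -> kappa @: F \subset T -> #|F| = i.+1 ->
    coboundary phi F = 0) ->
  exists psi, forall F, F \in faces D -> kappa @: F \subset T -> #|F| = i ->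
    phi F = coboundary psi F.

Lemma card_colorsD T F : F \in faces D -> kappa @: F \subset T ->
  (#|T :\: kappa @: F| + #|F| = #|T|)%N.
Proof.
move=> FD sFT; rewrite -(card_in_imset (kappaP FD)) cardsDS // subnK //.
exact: subset_leq_card.
Qed.

(** A squarefree cycle splits into cocycles, one for each [T]; their primitives [psi T] assemble
    into one Koszul chain. *)
Lemma cohomology_exact_koszul j :
  (forall T i, #|T| = (i + j)%N -> cohomology_exact T i) ->
  koszul_exact theta J j.
Proof.
move=> exT c /squarefree_homologous [c' [c'_sf cycle_c' [e eP]]].
have /choice [psi psiP] T : exists psi, forall F, F \in faces D ->
    kappa @: F \subset T -> (#|F| + j)%N = #|T| ->
    cochain_of c' T F = coboundary psi F.
  have [le_jT|lt_Tj] := leqP j #|T|; last first.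
    (* No face satisfies the size condition when [T] has fewer than [j] colours, so any value
       serves. *)
    by exists (fun=> 0) => F _ _; lia.
  have [|F FD sFT FT|psi psiP] := exT T (#|T| - j)%N _ (cochain_of c' T).
  - by rewrite subnK.
  - rewrite -cochain_of_koszul // (cochain_of_eq (c' := fun=> 0)) //.
      by rewrite /cochain_of mcoeff0 mulr0.
    by rewrite subr0; apply: cycle_c'; have := card_colorsD FD sFT; lia.
  - by exists psi => F FD sFT FT; apply: psiP => //; lia.
exists (fun U => e U + squarefree_chain psi U) => U Uj.
rewrite koszulD.
have -> : c U - (koszul theta e U + koszul theta (squarefree_chain psi) U) =
  (c U - c' U - koszul theta e U) + (c' U - squarefree_chain (cochain_of c') U)
  - (koszul theta (squarefree_chain psi) U - squarefree_chain (cochain_of c') U).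
  by ring.
apply: idealB => //; first by apply: idealD => //; [apply: eP | apply: squarefree_cochain].
have -> : squarefree_chain (cochain_of c') U =
  squarefree_chain (fun T => coboundary (psi T)) U; last exact: koszul_squarefree_chain.
apply: eq_bigr => F /andP [FD disj]; congr (_ * _ *: _).
apply: psiP => //; first exact: subsetUl.
rewrite cardsU -(card_in_imset (kappaP FD)) Uj.
by move: disj; rewrite -setI_eq0 => /eqP ->; rewrite cards0 subn0.
Qed.

Lemma koszul_cohomology_exact T i j : #|T| = (i + j)%N ->
  koszul_exact theta J j -> cohomology_exact T i.
Proof.
move=> Tij ex phi dphi.
(* The cocycle is placed in colour degree [T] alone; a Koszul primitive is read back in the same
   degree. *)
pose g T' F := if T' == T then phi F else 0.
have [W Wj|b bP] := ex (squarefree_chain g).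
  rewrite -[koszul _ _ _](subrK (squarefree_chain (fun T => coboundary (g T)) W)).
  apply: idealD => //; first exact: koszul_squarefree_chain.
  rewrite /squarefree_chain big1; first exact: ideal0.
  move=> F /andP [FD disj]; rewrite [coboundary _ _](_ : _ = 0) ?mulr0 ?scale0r //.
  rewrite /g; case: eqP => [ET|_]; last first.
    by rewrite /coboundary big1 // => v _; rewrite mulr0.
  have sFT : kappa @: F \subset T by rewrite -ET subsetUl.
  apply: dphi => //; have := card_colorsD FD sFT.
  rewrite Tij -Wj -{1}ET setDUl setDv set0U.
  have /setDidPl -> : [disjoint W & kappa @: F] by rewrite disjoint_sym.
  by lia.
exists (cochain_of b T) => F FD sFT Fi.
rewrite -cochain_of_koszul // -(cochain_of_eq (c := squarefree_chain g)) //.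
  by rewrite cochain_of_squarefree_chain // /g eqxx.
by apply: bP; have := card_colorsD FD sFT; lia.
Qed.

End StanleyReisnerKoszul.

(** * The Stanley-Reisner ring *)

Lemma radical_is_ideal (R : comNzRingType) (I : R -> Prop) :
  is_ideal I -> is_ideal (fun r => exists n, I (r ^+ n)).
Proof.
move=> iI; split.
- by exists 1; rewrite expr1; apply: ideal0.
- move=> x y [n In] [m Im]; exists (n + m)%N; rewrite exprDn.
  apply: ideal_sum => // i _; rewrite -mulr_natl; apply: idealM => //.
  have [le_mi|lt_im] := leqP m i.
    by rewrite -(subnK le_mi) exprD mulrA; apply: idealM.
  rewrite -(@subnK n (n + m - i)) ?exprD; last by lia.
  by rewrite -mulrA [_ * y ^+ i]mulrC mulrA; apply: idealM.
- by move=> a x [n In]; exists n; rewrite exprMn; apply: idealM.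
Qed.

(** Chains lift along a section of [f], so exactness over k[D] can be computed with polynomials
    modulo the ideal. *)
Lemma koszul_exact_surj (R Q : comNzRingType) (f : {rmorphism R -> Q}) d
    (theta : 'I_d -> R) j : (forall y, exists x, f x = y) ->
  koszul_exact (f \o theta) (in_ideal [::]) j <->
  koszul_exact theta (fun r => f r = 0) j.
Proof.
move=> f_surj; have [g gP] := choice f_surj.
have in0 (x : Q) : in_ideal [::] x <-> x = 0.
  by split=> [/in_ideal_nil //|->]; apply: ideal0; apply: in_ideal_is_ideal.
have fkoszul c W : f (koszul theta c W) = koszul (f \o theta) (f \o c) W.
  by rewrite rmorph_sum; apply: eq_bigr => i _; rewrite !rmorphM /= rmorph_sign.
have gK (c : {set 'I_d} -> Q) : f \o (g \o c) = c by apply/funext => U; apply: gP.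
split=> ex c cycle_c.
  have [W Wj|b bP] := ex (f \o c).
    by apply/in0; rewrite -fkoszul cycle_c.
  exists (g \o b) => U Uj; rewrite rmorphB fkoszul gK.
  exact/in0/bP.
have [W Wj|b bP] := ex (g \o c).
  by rewrite fkoszul gK; apply/in0/cycle_c.
exists (f \o b) => U Uj; apply/in0.
by have := bP U Uj; rewrite rmorphB fkoszul /= gP.
Qed.

Section SRRing.

Variables (k : fieldType) (V : finType) (D : simplicial_complex V).
Variables (d : nat) (kappa : V -> 'I_d).
Hypothesis kappaP : forall F, F \in faces D -> {in F &, injective kappa}.

Local Notation S := {mpoly k[#|V|]}.
Local Notation J := (in_ideal (sr_generators k D)).

Definition sr_pi : {rmorphism S -> sr_ring k D} := \pi_(sr_ring k D)%qT.

Lemma sr_pi_surj y : exists x, sr_pi x = y.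
Proof. by exists (repr y); apply: reprK. Qed.

Lemma sr_pi_eq0 p : sr_pi p = 0 <-> J p.
Proof.
have -> : J p <-> p - 0 \in @sr_ideal k V D by rewrite subr0; split=> /asboolP.
rewrite Quotient.idealrBE /=; split=> [p0|/eqP ->]; last by rewrite piE.
by apply/eqP; rewrite [LHS]p0 piE.
Qed.

Lemma sr_ring_noetherian : noetherian (sr_ring k D).
Proof. exact: surj_noetherian sr_pi_surj (@mpoly_noetherian _ _). Qed.

(** The constant term is well defined on k[D] because the empty set is a face, and it vanishes on
    the variables. *)
Lemma irrelevant_ideal_proper : ~ in_ideal (irrelevant_ideal k D) 1.
Proof.
pose I (r : sr_ring k D) := exists2 p : S, sr_pi p = r & p@_0%MM = 0.
have iI : is_ideal I.
  split; first by exists 0; rewrite ?rmorph0 ?mcoeff0.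
    move=> _ _ [p <- p0] [q <- q0]; exists (p + q); first exact: rmorphD.
    by rewrite mcoeffD p0 q0 addr0.
  move=> a _ [p <- p0]; have [b <-] := sr_pi_surj a.
  by exists (b * p); rewrite rmorphM //= p0 mulr0.
move=> /(in_ideal_min iI) [].
  move=> _ /imageP [v _ ->]; exists (vertex_var k v) => //.
  by rewrite mcoeffX mnm1_eq0.
move=> p p1 p0; have : sr_pi (p - 1) = 0 by rewrite rmorphB rmorph1 p1 subrr.
have face0 : face_mono D 0%MM.
  rewrite /face_mono (_ : mono_supp _ = set0) ?face_empty //.
  by apply/setP => v; rewrite !inE /mono_exp mnm0E.
move=> /sr_pi_eq0 /sr_idealP /(_ _ face0) /eqP.
by rewrite mcoeffB p0 mcoeff1 eqxx sub0r oppr_eq0 oner_eq0.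
Qed.

Lemma theta_irrelevant i :
  in_ideal (irrelevant_ideal k D) (sr_pi (theta k kappa i)).
Proof.
rewrite rmorph_sum; apply: ideal_sum => [|v _]; first exact: in_ideal_is_ideal.
by apply: mem_in_ideal; apply: image_f.
Qed.

(** Two distinct vertices of one colour lie in no common face, so their product vanishes in k[D]. *)
Lemma var_sqr v : J (vertex_var k v ^+ 2 - vertex_var k v * theta k kappa (kappa v)).
Proof.
apply/sr_idealP => m mD; rewrite mcoeffB expr2 [X in _ - X@_m]mulrC.
rewrite mcoeff_varM mcoeff_theta; case: ifP => [vm|vm].
  by rewrite (big_color kappaP) // subrr.
rewrite big1 ?subr0 // => u /andP [um _]; rewrite mcoeffX; case: eqP => // Em.
move: vm; rewrite -[m](@submK _ (mono_var u)) ?mono_var_le -?mem_mono_supp //.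
by rewrite -Em mem_mono_supp !mono_expE eqxx.
Qed.

Lemma irrelevant_radical r : in_ideal (irrelevant_ideal k D) r ->
  exists n, in_ideal (codom (sr_pi \o theta k kappa)) (r ^+ n).
Proof.
have iI := in_ideal_is_ideal (codom (sr_pi \o theta k kappa)).
apply: (in_ideal_min (radical_is_ideal iI)).
move=> _ /imageP [v _ ->]; exists 2%N.
have /sr_pi_eq0 := var_sqr v.
rewrite rmorphB rmorphXn rmorphM => /eqP; rewrite subr_eq0 => /eqP ->.
by apply: idealM => //; apply/mem_in_ideal/codomP; exists (kappa v).
Qed.

(** Otherwise 1 would be a boundary, hence in the ideal of the [theta i]. This will show that the
    minimum is over a nonempty set and is at most d. *)
Lemma koszul_not_exact0 :
  ~ koszul_exact (sr_pi \o theta k kappa) (in_ideal [::]) 0.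
Proof.
move=> ex; have [//|b bP] := ex (fun=> 1).
apply: irrelevant_ideal_proper.
have /in_ideal_nil/eqP := bP set0 (cards0 _); rewrite subr_eq0 => /eqP ->.
apply: ideal_sum => [|i _]; first exact: in_ideal_is_ideal.
apply: idealMl; first exact: in_ideal_is_ideal.
by apply: idealM; [exact: in_ideal_is_ideal | apply: theta_irrelevant].
Qed.

Lemma sr_koszul_exact j :
  koszul_exact (sr_pi \o theta k kappa) (in_ideal [::]) j <->
  koszul_exact (theta k kappa) J j.
Proof.
rewrite koszul_exact_surj; last exact: sr_pi_surj.
suff -> : (fun r => sr_pi r = 0) = J by [].
by apply/funext => p; apply/propext/sr_pi_eq0.
Qed.

Lemma reduced_homology_cohomology (P : 'I_d -> {set V}) (A : {set 'I_d}) i :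
  (forall v j, (v \in P j) = (kappa v == j)) ->
  (exists h : reduced_homology k (color_deleted D P A) (i%:Z - 1), h != 0) <->
  ~ cohomology_exact k D kappa (~: A) i.
Proof.
move=> kP; set K := color_deleted D P A.
have KE F : F \in K <-> F \in faces D /\ kappa @: F \subset ~: A.
  rewrite inE; split=> [/andP [FD /forall_inP FA]|[FD sFA]]; last first.
    apply/andP; split=> //; apply/forall_inP => j jA; apply/eqP/setP => v.
    rewrite !inE kP; apply/negP => /andP [vF /eqP vj].
    by have := subsetP sFA _ (imset_f kappa vF); rewrite inE vj jA.
  split=> //; apply/subsetP => _ /imsetP [v vF ->]; rewrite inE.
  apply/negP => /FA /eqP /setP /(_ v); rewrite !inE vF kP eqxx.
  by [].
have -> : cohomology_exact k D kappa (~: A) i <->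
    (forall z, z \in cycles k K (i%:Z - 1) -> z \in boundaries k K (i%:Z - 1)).
  rewrite homology_cohomology; split=> ex phi dphi.
    have [F FD sFA Fi|psi psiP] := ex phi; first by apply: dphi => //; apply/KE.
    by exists psi => F /KE [FD sFA]; apply: psiP.
  have [F /KE [FD sFA]|psi psiP] := ex phi; first exact: dphi.
  by exists psi => F FD sFA; apply: psiP; apply/KE.
rewrite reduced_homology_neq0; split=> [[z zZ /negP zB] ex|].
  exact/zB/ex.
by move=> /existsNP [z /not_implyP [zZ /negP zB]]; exists z.
Qed.

End SRRing.

Theorem theorem4p4 (k : fieldType) (V : finType) (d : nat)
    (D : simplicial_complex V) (P : 'I_d -> {set V}) (hD : balanced D P) :
  exists n : nat,
    is_depth (irrelevant_ideal k D) n
    /\ is_minimum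
         (fun m => exists (i : nat) (S : {set 'I_d}),
            m = (i + #|S|)%N
            /\ exists h : reduced_homology k (color_deleted D P S) (i%:Z - 1),
                 h != 0)
         n.
Proof.
case: hD => _ cover disj face1.
have /choice [kappa vP] v : exists i, v \in P i.
  have : v \in [set: V] by []; rewrite -cover => /bigcupP [i _ vi]; by exists i.
have kP v j : (v \in P j) = (kappa v == j).
  apply/idP/eqP => [vj|<- //]; apply/eqP/negPn/negP => /disj /disjointFr.
  by move=> /(_ v (vP v)); rewrite vj.
have kappaP F : F \in faces D -> {in F &, injective kappa}.
  move=> FD u v uF vF uv; apply: contraTeq (face1 F (kappa u) FD) => neq_uv.
  rewrite -ltnNge; apply/card_gt1P; exists u, v.
  by rewrite !in_setI uF vF !kP uv eqxx.
pose A m := exists (i : nat) (T : {set 'I_d}), m = (i + #|T|)%N /\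
  exists h : reduced_homology k (color_deleted D P T) (i%:Z - 1), h != 0.
have cardC (T : {set 'I_d}) : (#|T| + #|~: T|)%N = d.
  by rewrite cardsC card_ord.
pose ex j := koszul_exact (sr_pi k D \o theta k kappa) (in_ideal [::]) j.
(* Nonzero homology in degree [j] comes from some [T] with i + j colours; its complement has d - i -
   j, which gives the value d - j. *)
have A_of_ex j : (j <= d)%N -> ~ ex j -> A (d - j)%N.
  move=> jd; rewrite /ex sr_koszul_exact => nex; apply: contrapT => nA.
  apply: nex; apply: cohomology_exact_koszul => // T i Ti; apply: contrapT => nexT.
  apply: nA; exists i, (~: T); split; first by have := cardC T; lia.
  by apply/(@reduced_homology_cohomology k V D d kappa P _ _ kP); rewrite setCK.
have ex_of_A m : A m -> (m <= d)%N -> ~ ex (d - m)%N.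
  case=> i [T [-> /(@reduced_homology_cohomology k V D d kappa P _ _ kP) nexT]] md.
  rewrite /ex sr_koszul_exact => exm; apply: nexT.
  apply: koszul_cohomology_exact exm => //.
  by have := cardC T; lia.
have Ad : A d by have := A_of_ex 0 (leq0n d) (@koszul_not_exact0 _ _ _ _ _); rewrite subn0.
have [|n An nmin] := @nat_min A; first by exists d.
have nd : (n <= d)%N by apply: nmin.
exists n; split; last by split.
apply: (@koszul_is_depth _ d (sr_pi k D \o theta k kappa)) => //.
- exact: sr_ring_noetherian.
- exact: irrelevant_ideal_proper.
- exact: theta_irrelevant.
- exact: irrelevant_radical.
- move=> j dj; have [jd|] := leqP j d; last first.
    by move=> dj2; apply: koszul_exact_large.
  (* Nonzero homology in degree j > d - n would put d - j < n into [A], against minimality. *)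
  by apply: contrapT => /(A_of_ex j jd) /nmin; lia.
- exact: ex_of_A.
Qed.
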